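(* For every fixed constant $r \ge 1$, the problem $r$-AV-2 ($r$-SP-AV control by adding votes in 2-peaked elections) is solvable in polynomial time.
   Context: An $r$-SP-AV election consists of a finite set of candidates and a finite multiset of votes, each vote being a linear order over all candidates. Each vote gives 1 point to each of the $r$ candidates in its top $r$ positions and 0 points to all other candidates; the score of a candidate is the total number of points it receives. A candidate is the unique winner if its score is strictly larger than the score of every other candidate. Let $\mathcal{L}$ be a linear ordering of a candidate set. A vote $\succ_v$ over a set $C$ is single-peaked with respect to a linear ordering $L$ of $C$ if for all $a,b,c \in C$ such that $b$ lies between $a$ and $c$ in $L$, $c \succ_v b$ implies $b \succ_v a$. For a set $C'$ of candidates, $\pi_v(C')$ denotes the restriction of the vote $\pi_v$ to $C'$ (preserving relative order). A vote $\pi_v$ over the candidates ordered by $\mathcal{L}=(c_1,\dots,c_m)$ is $k$-peaked with respect to $\mathcal{L}$ if $\mathcal{L}$ can be split into at most $k$ nonempty consecutive blocks $L_1=(c_1,\dots,c_i), L_2=(c_{i+1},\dots,c_{i+j}),\dots$ such that for each block $L_t$, the restricted vote $\pi_v(\mathcal{C}(L_t))$ is single-peaked with respect to $L_t$, where $\mathcal{C}(L_t)$ is the set of candidates in $L_t$. Problem $r$-AV-$k$: Input: an $r$-SP-AV election with candidate set $\mathcal{C}\cup\{p\}$ ($p$ the distinguished candidate) and a multiset $\Pi_{\mathcal{V}}$ of registered votes, a multiset $\Pi_{\mathcal{T}}$ of unregistered votes, a linear ordering $\mathcal{L}$ of $\mathcal{C}\cup\{p\}$ such that every vote in $\Pi_{\mathcal{V}}$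 and in $\Pi_{\mathcal{T}}$ is $k$-peaked with respect to $\mathcal{L}$, and an integer $0\le R\le|\Pi_{\mathcal{T}}|$. Question: is there a submultiset $\Pi_{\mathcal{T}'}$ of $\Pi_{\mathcal{T}}$ with at most $R$ votes such that $p$ is the unique winner of the $r$-SP-AV election with candidates $\mathcal{C}\cup\{p\}$ and votes $\Pi_{\mathcal{V}}\uplus\Pi_{\mathcal{T}'}$? *)

(* Defs.v *)
From mathcomp Require Import all_boot.
Set Implicit Arguments.
Unset Strict Implicit. Unset Printing Implicit Defensive.

(* Elections.  Candidates are 0, ..., n-1.  A vote (and the axis L) is *)
(* a seq nat listing all candidates, most preferred first.             *)

Definition prefers (v : seq nat) (x y : nat) : bool := index x v < index y v.

Definition between (B : seq nat) (a b c : nat) : bool :=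
  (index a B < index b B < index c B) || (index c B < index b B < index a B).

Definition single_peaked (w B : seq nat) : Prop :=
  forall a b c, a \in B -> b \in B -> c \in B -> between B a b c ->
    prefers w c b -> prefers w b a.

Definition restrict (v C : seq nat) : seq nat := [seq x <- v | x \in C].

Definition k_peaked (k : nat) (L v : seq nat) : Prop :=
  exists Ls : seq (seq nat),
    [/\ flatten Ls = L, all (fun B => B != [::]) Ls, size Ls <= k &
        forall B, B \in Ls -> single_peaked (restrict v B) B].

Definition score (r : nat) (votes : seq (seq nat)) (c : nat) : nat :=
  count (fun v => index c v < r) votes.

Definition unique_winner (r n : nat) (votes : seq (seq nat)) (p : nat) : Prop :=
  forall c, c < n -> c != p -> score r votes c < score r votes p.

Record instance := Instance {
  ncand : nat;            (* candidate set C u {p} = {0,...,ncand-1} *)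
  pcand : nat;
  axis : seq nat;
  registered : seq (seq nat);
  unregistered : seq (seq nat);
  budget : nat
}.

Definition is_linear_order (n : nat) (v : seq nat) : bool := perm_eq v (iota 0 n).

Definition valid_instance (k : nat) (I : instance) : Prop :=
  [/\ pcand I < ncand I,
      is_linear_order (ncand I) (axis I),
      all (is_linear_order (ncand I)) (registered I ++ unregistered I),
      budget I <= size (unregistered I) &
      forall v, v \in registered I ++ unregistered I -> k_peaked k (axis I) v].

Definition yes_instance (r : nat) (I : instance) : Prop :=
  exists m : bitseq,
    size (mask m (unregistered I)) <= budget I /\
    unique_winner r (ncand I) (registered I ++ mask m (unregistered I)) (pcand I).

(* Encoding of instances as bit strings (numbers in unary; all numbers *)
(* in an instance are bounded by its size, so this is polynomially     *)
(* equivalent to any standard binary encoding).                        *)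
Definition enc_nat (k : nat) : seq bool := rcons (nseq k true) false.
Definition enc_list (s : seq nat) : seq bool :=
  enc_nat (size s) ++ flatten (map enc_nat s).
Definition enc_lists (ss : seq (seq nat)) : seq bool :=
  enc_nat (size ss) ++ flatten (map enc_list ss).
Definition encode (I : instance) : seq bool :=
  enc_nat (ncand I) ++ enc_nat (pcand I) ++ enc_list (axis I) ++
  enc_lists (registered I) ++ enc_lists (unregistered I) ++ enc_nat (budget I).

Inductive move := MLeft | MRight | MStay.

Record TM := MkTM {
  nstates : nat;
  delta : 'I_nstates.+1 -> option bool -> 'I_nstates.+1 * option bool * move;
  start : 'I_nstates.+1;
  accept : 'I_nstates.+1;
  reject : 'I_nstates.+1;
  accept_neq_reject : accept != reject
}.

(* configuration: state, tape left of head (nearest first), head cell,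
   tape right of head *)
Definition config (M : TM) : Type :=
  ('I_(nstates M).+1 * seq (option bool) * option bool * seq (option bool))%type.

Definition step (M : TM) (c : config M) : config M :=
  let: (q, l, h, rt) := c in
  if (q == accept M) || (q == reject M) then c else
  let: (q', w, mv) := delta q h in
  match mv with
  | MStay => (q', l, w, rt)
  | MLeft => match l with
             | [::] => (q', [::], None, w :: rt)
             | x :: l' => (q', l', x, w :: rt)
             end
  | MRight => match rt with
              | [::] => (q', w :: l, None, [::])
              | x :: rt' => (q', w :: l, x, rt')
              end
  end.

Arguments step : clear implicits.

Definition init (M : TM) (x : seq bool) : config M :=
  (start M, [::], head None (map Some x), behead (map Some x)).

Definition run (M : TM) (t : nat) (x : seq bool) : config M :=
  iter t (step M) (init M x).

Arguments init : clear implicits.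
Arguments run : clear implicits.

Definition state_of (M : TM) (c : config M) : 'I_(nstates M).+1 :=
  let: (q, _, _, _) := c in q.

(* M, started on x, has halted in the accepting (resp. rejecting) state
   after at most t steps (halting states are absorbing). *)
Definition accepts_within (M : TM) (t : nat) (x : seq bool) : Prop :=
  state_of (run M t x) = accept M.
Definition rejects_within (M : TM) (t : nat) (x : seq bool) : Prop :=
  state_of (run M t x) = reject M.

(* Main.v *)
Require Import Defs.
From mathcomp Require Import all_boot zify.
Set Implicit Arguments.
Unset Strict Implicit.
Unset Printing Implicit Defensive.

(* In a 2-peaked vote the r approved candidates form at most two intervals of
   the axis.  Only votes approving p are worth adding; the approved candidates
   of such a vote that are at distance at least r from p lie in the interval
   not containing p, hence among r consecutive positions.  So
   one can guess the number k of added votes and sweep the axis from left to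
   right, deciding about each vote when its first far approved position is
   reached, while remembering only 3r counters: the numbers of approvals gained
   by the 2r positions around p and by the next r positions.  The states of the
   sweep are digit vectors whose moves increase their value in base N (the input
   length), so reachability is computed by one pass over a table of N ^ (3 + 3r)
   bits.  The pass is written in a language whose only loops run N times, so
   its running time is polynomial by construction, and is compiled to a
   register machine, which a Turing machine simulates. *)

(** * Simulation of a register machine by a Turing machine *)

(** Guessing [k] first is what makes the sweep possible: every added vote approves p, so p ends with
    its registered score plus [k], and a far position can be tested against this value before all
    votes are chosen. Its own count is final once the sweep passes it, because a vote decided later
    has no far approval further left. Near positions may be approved by votes decided anywhere, so
    they are counted until the end, where the counter of p itself is compared with the guess. An
    approved interval has at most r members, so the one containing p stays at distance less than r
    from p; hence far approvals fall into the other block of the axis. The unary encoding makes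
    every number of the instance smaller than N, so positions, vote indices and counters are digits
    in base N. The leading digits are [k], the position and the vote index; a move raises one of
    them and otherwise changes only less significant digits, so the behaviour of the counters does
    not affect monotonicity. Acceptance is represented by the address N ^ (3 + 3r), the first one
    beyond the table. *)

Record store := Store { reg : nat -> nat; bits : bool -> nat -> bool }.

Definition set_reg (s : store) (x v : nat) : store :=
  Store (fun y => if y == x then v else reg s y) (bits s).

Definition set_mem (s : store) (b : bool) (i : nat) : store :=
  Store (reg s) (fun b' j => bits s b' j || (b' == b) && (j == i)).

Inductive instr :=
| IInc of nat
| IZero of nat
| ISet of bool & nat
| ILt of nat & nat & nat
| ITest of bool & nat & nat
| IJmp of nat
| IPop of nat & nat & nat
| IHalt of bool.

Definition istate : Type := (nat * store * seq bool)%type.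

Definition iexec (i : instr) (c : istate) : istate :=
  let: (pc, s, u) := c in
  match i with
  | IInc x => (pc.+1, set_reg s x (reg s x).+1, u)
  | IZero x => (pc.+1, set_reg s x 0, u)
  | ISet b x => (pc.+1, set_mem s b (reg s x), u)
  | ILt x y l => (if reg s x < reg s y then pc.+1 else l, s, u)
  | ITest b x l => (if bits s b (reg s x) then pc.+1 else l, s, u)
  | IJmp l => (l, s, u)
  | IPop l1 l2 l3 =>
      if u is b :: u' then (if b then l1 else l2, s, u') else (l3, s, u)
  | IHalt _ => c
  end.

Definition reg_of (i : instr) : nat :=
  match i with
  | IInc x | IZero x | ISet _ x | ILt x _ _ | ITest _ x _ => x
  | _ => 0
  end.

Definition jump_of (i : instr) : nat :=
  match i with ILt _ _ l | ITest _ _ l => l | _ => 0 end.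

(** The machine decides [ILt x y l] by the mark it meets first when scanning away from block 0. With
    [y < x] the track of [y] precedes that of [x] inside a block, so a tie correctly counts as a
    failed strict comparison. *)
Definition wf_instr (K : nat) (i : instr) : bool :=
  (reg_of i < K) && (if i is ILt x y _ then y < x else true).

Section Simulation.
Variables (K : nat) (prog : seq instr).

Let B := K.+3.
Let instr_at pc := nth (IHalt false) prog pc.

(* A machine state consists of a program counter, a phase, and the offset of
   the head within its block.  Phase 0 dispatches on the instruction, 1 seeks
   the mark of its register, 2 moves that mark to the next block, 3, 4, 5 and
   16 return to block 0 (see home_code), 6 and 7 write and read a track of the
   current block, 8 to 12 pop the last input symbol, 13 to 15 create block 0,
   and 17 and 18 halt. *)
Definition mcode : Type := (nat * nat * nat)%type.

Definition target_of (i : instr) : nat :=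
  match i with
  | IZero x => x.+1
  | ISet b _ | ITest b _ _ => K.+1 + b
  | _ => 0
  end.

Definition home_code (pc ph : nat) : mcode :=
  match ph with
  | 3 => (pc.+1, 0, 0)
  | 4 => (jump_of (instr_at pc), 0, 0)
  | 5 => (pc, 6, 0)
  | _ => (0, 0, 0)
  end.

Definition accept_code : mcode := (0, 17, 0).
Definition reject_code : mcode := (0, 18, 0).

Definition mdelta (q : mcode) (a : option bool) : mcode * option bool * move :=
  let: (pc, ph, o) := q in
  let i := instr_at pc in
  let marked := a == Some true in
  let out := ((pc, ph, o.+1 %% B), a, MLeft) in
  let home := if (o == 0) && marked then (home_code pc ph, a, MStay)
              else ((pc, ph, (o + B.-1) %% B), a, MRight) in
  match ph with
  | 0 => match i with
         | IJmp l => ((l, 0, 0), a, MStay)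
         | IHalt b => (if b then accept_code else reject_code, a, MStay)
         | IPop _ _ _ => ((pc, 8, 0), a, MRight)
         | _ => ((pc, 1, 0), a, MStay)
         end
  | 1 => if (o == (reg_of i).+1) && marked then
           match i with
           | IInc _ => ((pc, 2, o.+1 %% B), None, MLeft)
           | IZero _ => ((pc, 5, o), None, MStay)
           | ISet _ _ => ((pc, 6, o), a, MStay)
           | ITest _ _ _ => ((pc, 7, o), a, MStay)
           | _ => ((pc, 3, o), a, MStay)
           end
         else if i is ILt _ y _ then
           if (o == y.+1) && marked then ((pc, 4, o), a, MStay) else out
         else out
  | 2 => if o == (reg_of i).+1 then ((pc, 3, o), Some true, MStay) else out
  | 3 | 4 | 5 | 16 => home
  | 6 => if o == target_of i then ((pc, 3, o), Some true, MStay) else out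
  | 7 => if o == target_of i then
           ((pc, if marked then 3 else 4, o), a, MStay) else out
  | 8 => ((pc, 9, 0), a, MRight)
  | 9 => if a is Some _ then (q, a, MRight) else ((pc, 10, 0), a, MLeft)
  | 10 => if a is Some b then ((pc, if b then 11 else 12, 0), None, MLeft)
          else (if i is IPop _ _ l then (l, 0, 0) else reject_code, a, MLeft)
  | 11 => if a is Some _ then (q, a, MLeft)
          else (if i is IPop l _ _ then (l, 0, 0) else reject_code, a, MLeft)
  | 12 => if a is Some _ then (q, a, MLeft)
          else (if i is IPop _ l _ then (l, 0, 0) else reject_code, a, MLeft)
  | 13 => ((0, 14, 0), a, MLeft)
  | 14 => ((0, 15, 0), a, MLeft)
  | 15 => if o <= K then ((0, 15, o.+1 %% B), Some true, MLeft)
          else ((0, 16, o), a, MStay)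
  | _ => (reject_code, a, MStay)
  end.

Definition in_range (q : mcode) : bool :=
  let: (pc, ph, o) := q in [&& pc < (size prog).+1, ph < 19 & o < B].

Definition nst := (size prog).+1 * 19 * B.

Definition code (q : mcode) : 'I_nst.+1 :=
  let: (pc, ph, o) := q in inord ((pc * 19 + ph) * B + o).

Definition decode (n : nat) : mcode := (n %/ B %/ 19, (n %/ B) %% 19, n %% B).

Arguments mdelta : simpl never.
Arguments decode : simpl never.
Arguments code : simpl never.

Lemma codeK (q : mcode) : in_range q -> decode (code q) = q.
Proof.
case: q => [[pc ph] o] /and3P[hpc hph ho].
have hlt : (pc * 19 + ph) * B + o < nst.+1.
  rewrite ltnS /nst; apply: (@leq_trans ((pc * 19 + ph).+1 * B)).
    by rewrite mulSn addnC leq_add2r ltnW.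
  rewrite leq_mul2r; apply/orP; right; lia.
rewrite /decode /code inordK //.
rewrite divnMDl // modnMDl (divn_small ho) (modn_small ho) addn0.
by rewrite divnMDl // modnMDl (divn_small hph) (modn_small hph) addn0.
Qed.

Lemma code_inj (q q' : mcode) :
  in_range q -> in_range q' -> (code q == code q') = (q == q').
Proof.
move=> hq hq'; apply/eqP/eqP => [e|->//].
by rewrite -(codeK hq) e codeK.
Qed.

Lemma accept_neq_reject_code : code accept_code != code reject_code.
Proof. by rewrite code_inj. Qed.

Definition machine : TM :=
  @MkTM nst
    (fun q a => let: (q', w, mv) := mdelta (decode q) a in (code q', w, mv))
    (code (0, 13, 0)) (code accept_code) (code reject_code)
    accept_neq_reject_code.

Local Notation mstep := (step machine).

Definition working (q : mcode) : bool :=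
  in_range q && (q.1.2 < 17).

Lemma step_working (q : mcode) l h rt : working q ->
  mstep (code q, l, h, rt) =
    let: (q', w, mv) := mdelta q h in
    match mv with
    | MStay => (code q', l, w, rt)
    | MLeft => (code q', behead l, head None l, w :: rt)
    | MRight => (code q', w :: l, head None rt, behead rt)
    end.
Proof.
case/andP=> hq hw; rewrite /step /=.
have -> : (code q == code accept_code) = false.
  rewrite code_inj //; apply/negbTE; apply: contraTneq hw => ->; by [].
have -> : (code q == code reject_code) = false.
  rewrite code_inj //; apply/negbTE; apply: contraTneq hw => ->; by [].
rewrite codeK //=; case: (mdelta q h) => [[q' w] []] //=.
  by case: l.
by case: rt.
Qed.

(* The block area lies to the left of the input, separated from it by one
   blank cell; the head is on cell z of that area. *)
Definition on_cell (F : nat -> option bool) (z : nat) (u : seq bool)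
    (q : mcode) (c : config machine) : Prop :=
  exists l e,
    c = (code q, l, F z,
         rev (mkseq F z) ++ None :: map Some (rev u) ++ nseq e None) /\
    forall i, nth None l i = F (z + i.+1).

Definition set_cell (F : nat -> option bool) z w y :=
  if y == z then w else F y.

Lemma on_cell_ext F G z u q c : F =1 G -> on_cell F z u q c -> on_cell G z u q c.
Proof.
move=> e [l [k [-> hl]]]; exists l, k; rewrite e; split; last by move=> i; rewrite -e.
by congr (_, _, rev _ ++ _); apply: eq_mkseq.
Qed.

Lemma mkseq_set_cell F z w : mkseq (set_cell F z w) z = mkseq F z.
Proof.
apply/eq_in_map => i; rewrite mem_iota add0n => /andP[_ hi].
by rewrite /set_cell ltn_eqF.
Qed.

Lemma on_cell_left F z u q c q' w : on_cell F z u q c -> working q ->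
  mdelta q (F z) = (q', w, MLeft) ->
  on_cell (set_cell F z w) z.+1 u q' (mstep c).
Proof.
move=> [l [e [-> hl]]] hw hd; rewrite step_working // hd.
exists (behead l), e; split.
  rewrite -nth0 hl addn1 mkseqS rev_rcons mkseq_set_cell /set_cell eqxx.
  by rewrite gtn_eqF.
move=> i; rewrite nth_behead hl /set_cell addSnnS gtn_eqF //; lia.
Qed.

Lemma on_cell_stay F z u q c q' w : on_cell F z u q c -> working q ->
  mdelta q (F z) = (q', w, MStay) ->
  on_cell (set_cell F z w) z u q' (mstep c).
Proof.
move=> [l [e [-> hl]]] hw hd; rewrite step_working // hd.
exists l, e; split; first by rewrite mkseq_set_cell /set_cell eqxx.
by move=> i; rewrite hl /set_cell gtn_eqF //; lia.
Qed.

Lemma on_cell_right F z u q c q' w : on_cell F z.+1 u q c -> working q ->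
  mdelta q (F z.+1) = (q', w, MRight) ->
  on_cell (set_cell F z.+1 w) z u q' (mstep c).
Proof.
move=> [l [e [-> hl]]] hw hd; rewrite step_working // hd.
exists (w :: l), e; split.
  rewrite mkseqS rev_rcons /=; congr (_, _, _, rev _ ++ _).
    by rewrite /set_cell ltn_eqF.
  apply/eq_in_map => i; rewrite mem_iota add0n => /andP[_ hi].
  by rewrite /set_cell ltn_eqF // ltnS ltnW.
case=> [|i] /=; first by rewrite addn1 /set_cell eqxx.
by rewrite hl /set_cell gtn_eqF //; [congr F; lia | lia].
Qed.

Lemma set_cell_id F z : set_cell F z (F z) =1 F.
Proof. by move=> y; rewrite /set_cell; case: eqP => // ->. Qed.

Definition reaches (t : nat) (c c' : config machine) : Prop :=
  exists2 k, k <= t & c' = iter k mstep c.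

Lemma reaches_trans t1 t2 c1 c2 c3 :
  reaches t1 c1 c2 -> reaches t2 c2 c3 -> reaches (t1 + t2) c1 c3.
Proof.
move=> [k1 h1 ->] [k2 h2 ->]; exists (k1 + k2); first lia.
by rewrite addnC iterD.
Qed.

Lemma reaches_step c : reaches 1 c (mstep c).
Proof. by exists 1. Qed.

(** The configuration reached is known only up to trailing blanks at both ends of the tape, hence
    the detour through [on_cell]. *)
Definition leads t c F z u q :=
  exists2 c', reaches t c c' & on_cell F z u q c'.

Lemma leads_ext t t' c F G z u q :
  leads t c F z u q -> t <= t' -> F =1 G -> leads t' c G z u q.
Proof.
move=> [c' [k hk ->] hc] ht e; exists (iter k mstep c).
  by exists k => //; apply: leq_trans ht.
exact: on_cell_ext hc.
Qed.

Lemma leads_step t c F G z u q z' q' :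
  (forall c', on_cell F z u q c' -> on_cell G z' u q' (mstep c')) ->
  leads t c F z u q -> leads t.+1 c G z' u q'.
Proof.
move=> h [c' hr hc]; exists (mstep c'); last exact: h.
by rewrite -addn1; apply: reaches_trans hr (reaches_step _).
Qed.

Lemma working_code pc ph o : pc <= size prog -> ph < 17 -> o < B ->
  working (pc, ph, o).
Proof. by move=> h1 h2 h3; rewrite /working /in_range ltnS h1 h2 h3 (ltn_trans h2). Qed.

Lemma leads_left t c F z u pc ph o q' w : leads t c F z u (pc, ph, o) ->
  pc <= size prog -> ph < 17 -> o < B ->
  mdelta (pc, ph, o) (F z) = (q', w, MLeft) ->
  leads t.+1 c (set_cell F z w) z.+1 u q'.
Proof.
move=> hl h1 h2 h3 hd; apply: leads_step hl => c' hc'.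
by apply: on_cell_left hc' _ hd; apply: working_code.
Qed.

Lemma leads_stay t c F z u pc ph o q' w : leads t c F z u (pc, ph, o) ->
  pc <= size prog -> ph < 17 -> o < B ->
  mdelta (pc, ph, o) (F z) = (q', w, MStay) ->
  leads t.+1 c (set_cell F z w) z u q'.
Proof.
move=> hl h1 h2 h3 hd; apply: leads_step hl => c' hc'.
by apply: on_cell_stay hc' _ hd; apply: working_code.
Qed.

Lemma leads_out F u pc ph n z t c :
  (forall y, z <= y < z + n ->
     mdelta (pc, ph, y %% B) (F y) = ((pc, ph, y.+1 %% B), F y, MLeft)) ->
  pc <= size prog -> ph < 17 ->
  leads t c F z u (pc, ph, z %% B) ->
  leads (t + n) c F (z + n) u (pc, ph, (z + n) %% B).
Proof.
move=> + hpc hph; elim: n z t => [|n IH] z t hd hl; first by rewrite !addn0.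
have hz := hd z; rewrite leqnn addnS ltnS leq_addr in hz.
have hl' := leads_left hl hpc hph (@ltn_pmod _ B isT) (hz isT).
rewrite !addnS -!addSn; apply: IH => [y hy|]; first by apply: hd; lia.
by apply: leads_ext hl' (leqnn _) (@set_cell_id F z).
Qed.

(** A move to the right lowers the offset by one, which [mdelta] computes as adding [B.-1] modulo
    [B]. *)
Lemma modn_pred z : z.+1 %% B + B.-1 = z %% B %[mod B].
Proof.
rewrite modnDml addSnnS prednK // modnDr modn_mod //.
Qed.

Lemma leads_home F u pc ph z t c :
  (forall y, y < z -> mdelta (pc, ph, y.+1 %% B) (F y.+1) =
      ((pc, ph, (y.+1 %% B + B.-1) %% B), F y.+1, MRight)) ->
  pc <= size prog -> ph < 17 ->
  leads t c F z u (pc, ph, z %% B) ->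
  leads (t + z) c F 0 u (pc, ph, 0).
Proof.
move=> + hpc hph; elim: z t => [|z IH] t hd hl.
  by rewrite addn0; rewrite mod0n in hl.
rewrite addnS -addSn; apply: IH => [y hy|]; first by apply: hd; lia.
have hl' : leads t.+1 c (set_cell F z.+1 (F z.+1)) z u
                 (pc, ph, (z.+1 %% B + B.-1) %% B).
  apply: leads_step hl => c' hc'; apply: on_cell_right hc' _ (hd _ (ltnSn z)).
  by apply: working_code; rewrite ?ltn_pmod.
rewrite modn_pred modn_mod in hl'.
by apply: leads_ext hl' (leqnn _) (@set_cell_id F z.+1).
Qed.

(* Cell i * B + j holds track j of block i: track 0 marks block 0, track x.+1
   marks the block whose index is the value of register x, and the last two
   tracks are the two bit arrays. *)
Definition cell (s : store) (z : nat) : option bool :=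
  let i := z %/ B in let j := z %% B in
  if (if j == 0 then i == 0 else
      if j <= K then reg s j.-1 == i else bits s (j == K.+2) i)
  then Some true else None.

Lemma cellE s i j : j < B -> cell s (i * B + j) =
  if (if j == 0 then i == 0 else
      if j <= K then reg s j.-1 == i else bits s (j == K.+2) i)
  then Some true else None.
Proof.
by move=> hj; rewrite /cell divnMDl // (divn_small hj) addn0 modnMDl modn_small.
Qed.

Definition reg_cell (s : store) x := reg s x * B + x.+1.

Lemma reg_cell_mod s x : x < K -> reg_cell s x %% B = x.+1.
Proof. by move=> hx; rewrite modnMDl modn_small // /B; lia. Qed.

(** Each register track carries exactly one mark, so the local test on offset and mark singles out
    one cell of the whole tape. *)
Lemma hitE s x y : x < K ->
  (y %% B == x.+1) && (cell s y == Some true) = (y == reg_cell s x).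
Proof.
move=> hx; rewrite /reg_cell (divn_eq y B).
have hm : y %% B < B by rewrite ltn_pmod.
move: (y %/ B) (y %% B) hm => i j hj.
rewrite modnMDl modn_small // cellE //; case: (eqVneq j x.+1) => [->|hne] /=.
  by rewrite hx eqn_add2r eqn_pmul2r // [i == _]eq_sym; case: (reg s x == i).
apply/esym/negbTE; apply: contra hne => /eqP e.
have /eqP := congr1 (modn^~ B) e.
by rewrite !modnMDl !modn_small // /B; lia.
Qed.

Lemma cell_reg s x : x < K -> cell s (reg_cell s x) = Some true.
Proof. by move=> hx; have /eqP := hitE s (reg_cell s x) hx; rewrite eqxx eqb_id => /andP[_ /eqP]. Qed.

Lemma split_cell y i j : j < B -> (y == i * B + j) = (y %/ B == i) && (y %% B == j).
Proof.
move=> hj; apply/eqP/andP => [->|[/eqP <- /eqP <-]]; last exact: divn_eq.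
by rewrite divnMDl // (divn_small hj) addn0 modnMDl modn_small // !eqxx.
Qed.

Lemma cell_set_reg s x v : x < K ->
  set_cell (set_cell (cell s) (reg_cell s x) None) (v * B + x.+1) (Some true)
  =1 cell (set_reg s x v).
Proof.
move=> hx y; rewrite /set_cell /reg_cell !split_cell /B; try lia.
rewrite -/B /cell /set_reg /=; move: (y %/ B) (y %% B) => i j.
have [->|hj] := eqVneq j x.+1; last first.
  rewrite !andbF; case: (j) hj => // j' hj; rewrite eqSS in hj.
  by rewrite /= (negbTE hj).
by rewrite !andbT /= hx eqxx eq_sym; case: eqP => // _; rewrite eq_sym; case: eqP.
Qed.

Lemma cell_set_mem s (b : bool) i :
  set_cell (cell s) (i * B + (K.+1 + b)) (Some true) =1 cell (set_mem s b i).
Proof.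
move=> y; rewrite /set_cell split_cell; last by rewrite /B; case: b; lia.
have hm : y %% B < B by rewrite ltn_pmod.
rewrite /cell /set_mem /=; move: (y %/ B) (y %% B) hm => k j hj.
case: (posnP j) => [->|hj0]; first by rewrite andbF.
rewrite ?(gtn_eqF hj0) /=; case: leqP => hjK.
  by rewrite (_ : (j == K.+1 + b) = false) ?andbF //; case: b; lia.
rewrite (_ : (j == K.+1 + b) = ((j == K.+2) == b)).
  by rewrite andbC; case: (_ && _); rewrite ?orbT ?orbF.
by move: hj; rewrite /B; case: b; case: eqP; lia.
Qed.

(** All that is needed to find the way back to block 0. Unlike the form [cell s], it persists on
    intermediate tapes where a register mark is missing. *)
Definition home_marked (F : nat -> option bool) :=
  forall y, y %% B = 0 -> (F y == Some true) = (y == 0).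

Lemma cell_home s : home_marked (cell s).
Proof.
move=> y hy; rewrite /cell hy eqxx {2}(divn_eq y B) hy addn0 muln_eq0 orbF.
by case: (y %/ B == 0).
Qed.

Lemma set_cell_home F z w : z %% B != 0 -> home_marked F -> home_marked (set_cell F z w).
Proof.
move=> hz hF y hy; rewrite /set_cell (_ : (y == z) = false) ?hF //.
by apply: contraNF hz => /eqP <-; rewrite hy.
Qed.

Lemma leads_return t c F z u pc ph o : leads t c F z u (pc, ph, o) ->
  o = z %% B -> ph \in [:: 3; 4; 5; 16] -> pc <= size prog -> home_marked F ->
  leads (t + z).+1 c F 0 u (home_code pc ph).
Proof.
move=> + ho hph hpc hF; rewrite {}ho => hl.
have hph' : ph < 17 by move: hph; rewrite !inE => /or4P[]/eqP ->.
have hd y : mdelta (pc, ph, y %% B) (F y) =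
    if y == 0 then (home_code pc ph, F y, MStay)
    else ((pc, ph, (y %% B + B.-1) %% B), F y, MRight).
  have -> : (y == 0) = (y %% B == 0) && (F y == Some true).
    case: (eqVneq (y %% B) 0) => [/hF -> //|]; apply: contraNF => /eqP ->.
    by rewrite mod0n.
  by rewrite /mdelta; move: hph; rewrite !inE => /or4P[]/eqP ->.
have hl' : leads (t + z) c F 0 u (pc, ph, 0).
  by apply: leads_home hl => // y _; rewrite hd.
have := leads_stay hl' hpc hph' isT; move: (hd 0); rewrite mod0n /= => -> /(_ _ _ erefl).
by move/leads_ext; apply=> //; apply: set_cell_id.
Qed.

Lemma leads_weaken t t' c F z u q : leads t c F z u q -> t <= t' -> leads t' c F z u q.
Proof. by move=> h ht; apply: leads_ext h ht (fun=> erefl). Qed.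

Definition at_instr t c (st : istate) :=
  let: (pc, s, u) := st in leads t c (cell s) 0 u (pc, 0, 0).

Lemma modSn_mod y : (y %% B).+1 %% B = y.+1 %% B.
Proof. by rewrite -addn1 modnDml addn1. Qed.

(** The two hypotheses on cells below [z] keep the scan from stopping early; the second concerns
    only the other operand of a comparison. *)
Lemma leads_seek t c s u pc z :
  at_instr t c (pc, s, u) -> pc < size prog ->
  match instr_at pc with IJmp _ | IHalt _ | IPop _ _ _ => false | _ => true end ->
  (forall y, y < z -> y != reg_cell s (reg_of (instr_at pc))) ->
  (forall y x x' l, y < z -> instr_at pc = ILt x x' l -> y != reg_cell s x') ->
  wf_instr K (instr_at pc) ->
  leads (t.+1 + z) c (cell s) z u (pc, 1, z %% B).
Proof.
move=> hl hpc hi h1 h2 hwf; have hpc' := ltnW hpc.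
have hr : reg_of (instr_at pc) < K by case/andP: hwf.
have hl1 : leads t.+1 c (cell s) 0 u (pc, 1, 0).
  have hd : mdelta (pc, 0, 0) (cell s 0) = ((pc, 1, 0), cell s 0, MStay).
    by rewrite /mdelta; case: (instr_at pc) hi.
  have := leads_stay hl hpc' isT isT hd.
  by move/leads_ext; apply=> //; apply: set_cell_id.
rewrite -[z in leads _ _ _ z]add0n -[z in z %% B]add0n.
apply: leads_out => //.
move=> y /andP[_ hy]; rewrite add0n in hy.
rewrite /mdelta hitE // (negbTE (h1 _ hy)).
case e : (instr_at pc) => [x|x|b x|x x' l|b x l|l|l1 l2 l3|b];
  rewrite ?modSn_mod //.
have hx' : x' < K.
  by move: hwf; rewrite e /wf_instr /= => /andP[? ?]; apply: ltn_trans (_ : x < K).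
by rewrite hitE // (negbTE (h2 _ _ _ _ hy e)).
Qed.


Lemma leads_target t c F z u pc ph : leads t c F z u (pc, ph, z %% B) ->
  (ph == 6) || (ph == 7) ->
  pc <= size prog -> z %% B <= target_of (instr_at pc) < B ->
  exists2 z', z' %% B = target_of (instr_at pc) &
    z' = z - z %% B + target_of (instr_at pc) /\
    leads (t + B) c F z' u (pc, ph, target_of (instr_at pc)).
Proof.
move=> hl hph hpc /andP[ho hB].
exists (z - z %% B + target_of (instr_at pc)).
  by rewrite {1}(divn_eq z B) addnK modnMDl modn_small.
split=> //; set z' := (z - _ + _).
have hz : z %% B <= z by apply: leq_mod.
have hz'm : z' %% B = target_of (instr_at pc).
  by rewrite /z' {1}(divn_eq z B) addnK modnMDl modn_small.
pose n := target_of (instr_at pc) - z %% B.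
have ez' : z + n = z' by rewrite /z' /n; lia.
rewrite -hz'm; apply: (@leads_weaken (t + n)); last by rewrite /n; lia.
rewrite -ez'; apply: leads_out => //; last by case/orP: hph => /eqP ->.
move=> y /andP[hy1 hy2].
have hne : (y %% B == target_of (instr_at pc)) = false.
  apply/negP => /eqP e.
  have : (y - z + z %% B) %% B = target_of (instr_at pc).
    by rewrite modnDmr subnK.
  rewrite modn_small; first by rewrite /n in hy2; lia.
  by rewrite /n in hy2; lia.
by case/orP: hph => /eqP ->; rewrite /mdelta modSn_mod hne.
Qed.

Lemma leads_write t c F z u pc : leads t c F z u (pc, 6, z %% B) ->
  pc < size prog -> (z %% B <= target_of (instr_at pc) < B) ->
  0 < target_of (instr_at pc) -> home_marked F ->
  leads (t + 3 * B + z) c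
    (set_cell F (z - z %% B + target_of (instr_at pc)) (Some true))
    0 u (pc.+1, 0, 0).
Proof.
move=> hl hpc ht h0 hF; have hpc' := ltnW hpc.
have [z' hz'm [ez hl1]] := leads_target hl isT hpc' ht; case/andP: ht => ho hB.
rewrite -ez.
have hd : mdelta (pc, 6, target_of (instr_at pc)) (F z') =
   ((pc, 3, target_of (instr_at pc)), Some true, MStay) by rewrite /mdelta eqxx.
have hl2 := leads_stay hl1 hpc' isT hB hd.
have hl3 := leads_return hl2 (esym hz'm) isT hpc'.
have hF' : home_marked (set_cell F z' (Some true)).
  by apply: set_cell_home hF; rewrite hz'm -lt0n.
apply: leads_weaken (hl3 hF') _.
have hz : z' <= z + B by rewrite ez leq_add ?leq_subr // ltnW.
have h3 : 3 <= B by [].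
by move: (B) h3 hz {hl hl1 hl2 hl3 hd} => b; lia.
Qed.

(** Covers, with slack, a walk to block [m + 1] and back, or the round trip of a pop over [n]
    remaining input symbols. *)
Definition icost (m n : nat) := 4 * B * (m + 3) + 2 * n + 20.

Lemma leads_inc t c s u pc x m : instr_at pc = IInc x -> at_instr t c (pc, s, u) ->
  x < K -> pc < size prog -> reg s x <= m ->
  at_instr (t + icost m (size u)) c (pc.+1, set_reg s x (reg s x).+1, u).
Proof.
move=> ei hl hx hpc hm; have hpc' := ltnW hpc.
pose z := reg_cell s x.
have hz : z <= m * B + B.
  by rewrite /z /reg_cell; apply: leq_add; [rewrite leq_mul2r hm orbT | rewrite /B; lia].
have hzm : z %% B = x.+1 by apply: reg_cell_mod.
have hx2 : x.+2 < B by rewrite /B; lia.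
have hl1 : leads (t.+1 + z) c (cell s) z u (pc, 1, z %% B).
  apply: leads_seek => //; rewrite ?ei //=; last by rewrite /wf_instr /= hx.
  by move=> y; rewrite ltn_neqAle => /andP[].
rewrite hzm in hl1.
have hd : mdelta (pc, 1, x.+1) (cell s z) = ((pc, 2, x.+2 %% B), None, MLeft).
  by rewrite /mdelta ei /= cell_reg // eqxx.
have hl2 := leads_left hl1 hpc' isT (ltnW hx2) hd.
pose F := set_cell (cell s) z None.
(* From [z.+1], another [B.-1] cells bring the offset back to [x.+1], now in the next block. *)
have hl3 : leads ((t.+1 + z).+1 + B.-1) c F (z.+1 + B.-1) u (pc, 2, (z.+1 + B.-1) %% B).
  apply: leads_out => // [y /andP[hy1 hy2]|].
    rewrite /mdelta modSn_mod ei /=; case: eqP => // e; exfalso.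
    have : (y - z + z %% B) %% B = x.+1 by rewrite modnDmr subnK // ltnW.
    have [hlt|hge] := ltnP (y - z + z %% B) B.
      by rewrite modn_small // hzm; lia.
    rewrite -{1}(subnK hge) modnDr modn_small hzm; lia.
  by rewrite -modSn_mod hzm.
have ez : z.+1 + B.-1 = z + B by rewrite /B; lia.
have em : (z + B) %% B = x.+1 by rewrite modnDr.
rewrite ez em in hl3.
have hd4 : mdelta (pc, 2, x.+1) (F (z + B)) = ((pc, 3, x.+1), Some true, MStay).
  by rewrite /mdelta ei eqxx.
have hl4 := leads_stay hl3 hpc' isT (ltnW hx2) hd4.
have hl5 := leads_return hl4 (esym em) isT hpc'; apply: leads_ext (hl5 _) _ _.
- by do 2 (apply: set_cell_home; first by rewrite ?em ?hzm); apply: cell_home.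
- by rewrite /icost; lia.
move=> y; rewrite -cell_set_reg // mulSn -addnA.
by rewrite [X in set_cell _ X]addnC.
Qed.

Lemma reg_cell_bound s x m : x < K -> reg s x <= m -> reg_cell s x <= m * B + B.
Proof.
move=> hx hm; rewrite /reg_cell; apply: leq_add; first by rewrite leq_mul2r hm orbT.
by rewrite /B; lia.
Qed.

Lemma leads_found t c s u pc :
  at_instr t c (pc, s, u) -> pc < size prog ->
  match instr_at pc with
  | IZero _ | ISet _ _ | ITest _ _ _ => true | _ => false end ->
  reg_of (instr_at pc) < K ->
  let z := reg_cell s (reg_of (instr_at pc)) in
  leads (t.+1 + z) c (cell s) z u (pc, 1, (reg_of (instr_at pc)).+1).
Proof.
move=> hl hpc hi hx z; rewrite -[X in (pc, 1, X)](reg_cell_mod s hx).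
apply: leads_seek => //.
- by case: (instr_at pc) hi.
- by move=> y; rewrite ltn_neqAle => /andP[].
- by move=> y x x' l _ e; rewrite e in hi.
- by move: hi hx; rewrite /wf_instr; case: (instr_at pc) => //= *; rewrite andbT.
Qed.

Lemma leads_zero t c s u pc x m : instr_at pc = IZero x -> at_instr t c (pc, s, u) ->
  x < K -> pc < size prog -> reg s x <= m ->
  at_instr (t + icost m (size u)) c (pc.+1, set_reg s x 0, u).
Proof.
move=> ei hl hx hpc hm; have hpc' := ltnW hpc.
have hl1 := leads_found hl hpc; rewrite ei /= in hl1; have {}hl1 := hl1 isT hx.
set z := reg_cell s x in hl1.
have hzm : z %% B = x.+1 by apply: reg_cell_mod.
have hz : z <= m * B + B by apply: reg_cell_bound.
have hx2 : x.+1 < B by rewrite /B; lia.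
have hd : mdelta (pc, 1, x.+1) (cell s z) = ((pc, 5, x.+1), None, MStay).
  by rewrite /mdelta ei /= cell_reg // eqxx.
have hl2 := leads_stay hl1 hpc' isT hx2 hd.
have hF : home_marked (set_cell (cell s) z None).
  by apply: set_cell_home; [rewrite hzm | apply: cell_home].
have hl3 := leads_return hl2 (esym hzm) isT hpc' hF.
have := @leads_write _ c _ 0 u pc hl3 hpc; rewrite ei => /(_ hx2 isT hF) hl4.
apply: leads_ext hl4 _ _; first by rewrite /icost; lia.
by move=> y; rewrite -cell_set_reg.
Qed.

Lemma leads_setm t c s u pc b x m : instr_at pc = ISet b x -> at_instr t c (pc, s, u) ->
  x < K -> pc < size prog -> reg s x <= m ->
  at_instr (t + icost m (size u)) c (pc.+1, set_mem s b (reg s x), u).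
Proof.
move=> ei hl hx hpc hm; have hpc' := ltnW hpc.
have hl1 := leads_found hl hpc; rewrite ei /= in hl1; have {}hl1 := hl1 isT hx.
set z := reg_cell s x in hl1.
have hzm : z %% B = x.+1 by apply: reg_cell_mod.
have hz : z <= m * B + B by apply: reg_cell_bound.
have hx2 : x.+1 < B by rewrite /B; lia.
have hd : mdelta (pc, 1, x.+1) (cell s z) = ((pc, 6, x.+1), cell s z, MStay).
  by rewrite /mdelta ei /= cell_reg // eqxx.
have hl2 := leads_ext (leads_stay hl1 hpc' isT hx2 hd) (leqnn _) (@set_cell_id _ z).
rewrite -hzm in hl2.
have := leads_write hl2 hpc; rewrite ei hzm /=.
have -> : x < K.+1 + b < B by rewrite /B; case: b {ei}; lia.
move=> /(_ isT isT (cell_home s)) hl3.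
apply: leads_ext hl3 _ _; first by rewrite /icost; lia.
move=> y; rewrite -cell_set_mem; congr set_cell.
by rewrite /z /reg_cell; lia.
Qed.

Lemma leads_test t c s u pc b x l m : instr_at pc = ITest b x l ->
  at_instr t c (pc, s, u) ->
  x < K -> pc < size prog -> reg s x <= m ->
  at_instr (t + icost m (size u)) c
    (if bits s b (reg s x) then pc.+1 else l, s, u).
Proof.
move=> ei hl hx hpc hm; have hpc' := ltnW hpc.
have hl1 := leads_found hl hpc; rewrite ei /= in hl1; have {}hl1 := hl1 isT hx.
set z := reg_cell s x in hl1.
have hzm : z %% B = x.+1 by apply: reg_cell_mod.
have hz : z <= m * B + B by apply: reg_cell_bound.
have hx2 : x.+1 < B by rewrite /B; lia.
have hd : mdelta (pc, 1, x.+1) (cell s z) = ((pc, 7, x.+1), cell s z, MStay).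
  by rewrite /mdelta ei /= cell_reg // eqxx.
have hl2 := leads_ext (leads_stay hl1 hpc' isT hx2 hd) (leqnn _) (@set_cell_id _ z).
rewrite -hzm in hl2.
have := leads_target hl2 isT hpc'; rewrite ei hzm /=.
have hb : x < K.+1 + b < B by rewrite /B; case: (b); lia.
move=> /(_ hb) [z' hz'm [ez' hl3]].
have {}ez' : z' = reg s x * B + (K.+1 + b) by rewrite ez' /z /reg_cell; lia.
have hc : (cell s z' == Some true) = bits s b (reg s x).
  rewrite ez' cellE; last by case/andP: hb.
  have -> : (K.+1 + b == 0) = false by [].
  have -> : (K.+1 + b <= K) = false by lia.
  have -> : (K.+1 + b == K.+2) = b by case: (b); rewrite ?addn1 ?addn0 ?eqxx // eqn_leq ltnn andbF.
  by case: (bits _ _ _).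
have hd3 : mdelta (pc, 7, K.+1 + b) (cell s z') =
    ((pc, if bits s b (reg s x) then 3 else 4, K.+1 + b), cell s z', MStay).
  by rewrite /mdelta ei hc /= eqxx.
have hB : K.+1 + b < B by case/andP: hb.
have hl4 := leads_ext (leads_stay hl3 hpc' isT hB hd3) (leqnn _) (@set_cell_id _ z').
have hph : (if bits s b (reg s x) then 3 else 4) \in [:: 3; 4; 5; 16] by case: (bits s b _).
have := leads_return hl4 (esym hz'm) hph hpc' (cell_home s).
have -> : home_code pc (if bits s b (reg s x) then 3 else 4) =
    ((if bits s b (reg s x) then pc.+1 else l), 0, 0).
  by case: (bits _ _ _); rewrite /home_code ?ei.
move=> hl5; apply: leads_weaken hl5 _; rewrite ez' /icost.
have : reg s x * B <= m * B by rewrite leq_mul2r hm orbT.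
lia.
Qed.

Lemma leads_lt t c s u pc x y l m : instr_at pc = ILt x y l ->
  at_instr t c (pc, s, u) -> y < x ->
  x < K -> pc < size prog -> reg s x <= m ->
  at_instr (t + icost m (size u)) c
    (if reg s x < reg s y then pc.+1 else l, s, u).
Proof.
move=> ei hl hyx hx hpc hm; have hpc' := ltnW hpc.
have hy := ltn_trans hyx hx.
have hzx := reg_cell_mod s hx; have hzy := reg_cell_mod s hy.
have hbx := reg_cell_bound hx hm.
have hxB : x.+1 < B by rewrite /B; lia.
have hyB : y.+1 < B by rewrite /B; lia.
have hcmp : if reg s x < reg s y then reg_cell s x < reg_cell s y
            else reg_cell s y < reg_cell s x.
  rewrite /reg_cell; case: ltnP => h.
    have : (reg s x).+1 * B <= reg s y * B by rewrite leq_mul2r h orbT.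
    by rewrite mulSn; lia.
  have : reg s y * B <= reg s x * B by rewrite leq_mul2r h orbT.
  by lia.
have hwf : wf_instr K (instr_at pc) by rewrite ei /wf_instr /= hx.
case: ifP hcmp => hlt hcmp.
  have hl1 : leads (t.+1 + reg_cell s x) c (cell s) (reg_cell s x) u
                   (pc, 1, reg_cell s x %% B).
    apply: leads_seek => //; rewrite ?ei //=.
      by move=> z; rewrite ltn_neqAle => /andP[].
    by move=> z _ _ _ hz [_ <- _]; rewrite neq_ltn (ltn_trans hz hcmp).
  rewrite hzx in hl1.
  have hd : mdelta (pc, 1, x.+1) (cell s (reg_cell s x)) =
      ((pc, 3, x.+1), cell s (reg_cell s x), MStay).
    by rewrite /mdelta ei /= cell_reg // eqxx.
  have hl2 := leads_ext (leads_stay hl1 hpc' isT hxB hd) (leqnn _) (@set_cell_id _ _).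
  apply: leads_weaken (leads_return hl2 (esym hzx) isT hpc' (cell_home s)) _.
  by rewrite /icost; lia.
have hl1 : leads (t.+1 + reg_cell s y) c (cell s) (reg_cell s y) u
                 (pc, 1, reg_cell s y %% B).
  apply: leads_seek => //; rewrite ?ei //=.
    by move=> z hz; rewrite neq_ltn (ltn_trans hz hcmp).
  by move=> z _ _ _ hz [_ <- _]; rewrite neq_ltn hz.
rewrite hzy in hl1.
have hd : mdelta (pc, 1, y.+1) (cell s (reg_cell s y)) =
    ((pc, 4, y.+1), cell s (reg_cell s y), MStay).
  by rewrite /mdelta ei /= cell_reg // eqSS (ltn_eqF hyx) !eqxx.
have hl2 := leads_ext (leads_stay hl1 hpc' isT hyB hd) (leqnn _) (@set_cell_id _ _).
have := leads_return hl2 (esym hzy) isT hpc' (cell_home s).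
rewrite /home_code ei => hl3.
by apply: leads_weaken hl3 _; rewrite /icost; lia.
Qed.

Lemma leads_jmp t c s u pc l : instr_at pc = IJmp l ->
  at_instr t c (pc, s, u) -> pc < size prog -> at_instr t.+1 c (l, s, u).
Proof.
move=> ei hl hpc; have hpc' := ltnW hpc.
have hd : mdelta (pc, 0, 0) (cell s 0) = ((l, 0, 0), cell s 0, MStay).
  by rewrite /mdelta ei.
exact: leads_ext (leads_stay hl hpc' isT isT hd) (leqnn _) (@set_cell_id _ _).
Qed.

Lemma leads_halt t c s u pc b : instr_at pc = IHalt b ->
  at_instr t c (pc, s, u) -> pc < size prog ->
  leads t.+1 c (cell s) 0 u (if b then accept_code else reject_code).
Proof.
move=> ei hl hpc; have hpc' := ltnW hpc.
have hd : mdelta (pc, 0, 0) (cell s 0) =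
   (if b then accept_code else reject_code, cell s 0, MStay) by rewrite /mdelta ei.
exact: leads_ext (leads_stay hl hpc' isT isT hd) (leqnn _) (@set_cell_id _ _).
Qed.

End Simulation.

(** * Consuming the input, setting up the tape, and complete runs *)

Section InputAndRun.
Variables (K : nat) (prog : seq instr).

Let B := K.+3.
Let instr_at pc := nth (IHalt false) prog pc.
Local Notation mstep := (step (machine K prog)).
Local Notation code := (code K prog).

Lemma scan_right pc v L e : pc <= size prog ->
  iter (size v) mstep (code (pc, 9, 0), L, head None (map Some v ++ nseq e None),
    behead (map Some v ++ nseq e None)) =
  (code (pc, 9, 0), rev (map Some v) ++ L, None, nseq e.-1 None).
Proof.
move=> hpc; elim: v L => [|b v IH] L; first by case: e.
rewrite [size _]/= iterSr [head _ _]/= [behead _]/= step_working.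
  by rewrite /mdelta IH [map _ (b :: v)]/= rev_cons cat_rcons.
exact: working_code.
Qed.

Lemma scan_left pc ph u Y R : pc <= size prog -> (ph == 11) || (ph == 12) ->
  iter (size u) mstep (code (pc, ph, 0), behead (map Some u ++ None :: Y),
     head None (map Some u ++ None :: Y), R) =
  (code (pc, ph, 0), Y, None, rev (map Some u) ++ R).
Proof.
move=> hpc hph; elim: u R => [|b u IH] R //.
rewrite [size _]/= iterSr [head _ _]/= [behead _]/= step_working.
  have -> : mdelta K prog (pc, ph, 0) (Some b) = ((pc, ph, 0), Some b, MLeft).
    by case/orP: hph => /eqP ->.
  by rewrite IH [map _ (b :: u)]/= rev_cons cat_rcons.
by case/orP: hph => /eqP ->; exact: working_code.
Qed.

(** Symbols are consumed from the far end, so the rest of the input stays next to the separator.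
    Hence [u] is the remaining input reversed, and erased cells join the trailing blanks counted by
    [e]. *)
Lemma pop_config F u pc l1 l2 l3 c : instr_at pc = IPop l1 l2 l3 ->
  pc < size prog -> @on_cell K prog F 0 u (pc, 0, 0) c ->
  exists2 k, k <= 2 * size u + 4 & 
    on_cell F 0 (behead u)
      (if u is b :: _ then if b then l1 else l2 else l3, 0, 0) (iter k mstep c).
Proof.
move=> ei hpc [l [e [-> hl]]]; have hpc' := ltnW hpc.
have hw ph : ph < 17 -> working K prog (pc, ph, 0) by move=> h; exact: working_code.
set c0 := (_, l, F 0, _).
have e1 : mstep c0 = (code (pc, 8, 0), F 0 :: l, None, map Some (rev u) ++ nseq e None).
  by rewrite /c0 step_working ?hw // /mdelta; move: ei; rewrite /instr_at => ->.
have e2 : iter 2 mstep c0 = (code (pc, 9, 0), None :: F 0 :: l,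
    head None (map Some (rev u) ++ nseq e None), behead (map Some (rev u) ++ nseq e None)).
  by rewrite iterS [iter 1 _ _]e1 step_working ?hw.
have e3 : iter (size u).+2 mstep c0 =
   (code (pc, 9, 0), map Some u ++ None :: F 0 :: l, None, nseq e.-1 None).
  by rewrite -addn2 iterD e2 -[size u]size_rev scan_right // -map_rev revK.
have e4 : iter (size u).+3 mstep c0 =
   (code (pc, 10, 0), behead (map Some u ++ None :: F 0 :: l),
    head None (map Some u ++ None :: F 0 :: l), None :: nseq e.-1 None).
  by rewrite iterS e3 step_working ?hw.
case: u c0 e1 e2 e3 e4 hl => [|b u] c0 e1 e2 e3 e4 hl.
  exists 4 => //; exists l, e.-1.+1; split=> //.
  rewrite iterS e4 step_working ?hw //=.
  by rewrite /mdelta; move: ei; rewrite /instr_at => ->.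
pose ph := if b then 11 else 12.
have hph : (ph == 11) || (ph == 12) by rewrite /ph; case: (b).
have hph' : ph < 17 by rewrite /ph; case: (b).
have e5 : iter (size u).+4.+1 mstep c0 =
   (code (pc, ph, 0), behead (map Some u ++ None :: F 0 :: l),
    head None (map Some u ++ None :: F 0 :: l), nseq e.-1.+2 None).
  by rewrite iterS e4 [head _ _]/= [behead _]/= step_working ?hw.
have e6 : iter ((size u).+1 + (size u).+4.+1) mstep c0 =
   (code (if b then l1 else l2, 0, 0), l, F 0,
    None :: rev (map Some u) ++ nseq e.-1.+2 None).
  rewrite iterD e5 iterS scan_left // step_working ?hw //.
  have -> : mdelta K prog (pc, ph, 0) None =
      ((if b then l1 else l2, 0, 0), None, MLeft) => //.
  by rewrite /mdelta /ph; move: ei; rewrite /instr_at => ->; case: (b).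
exists ((size u).+1 + (size u).+4.+1); first by rewrite /=; lia.
by exists l, e.-1.+2; rewrite e6 /= map_rev.
Qed.

Lemma leads_pop t c s u pc l1 l2 l3 : instr_at pc = IPop l1 l2 l3 ->
  @at_instr K prog t c (pc, s, u) -> pc < size prog ->
  at_instr (t + (2 * size u + 4)) c (iexec (IPop l1 l2 l3) (pc, s, u)).
Proof.
move=> ei [c' hr hc] hpc; have [k hk hc2] := pop_config ei hpc hc.
have hr2 := reaches_trans hr (ex_intro2 _ _ k hk erefl).
by case: u hc hc2 hr2 {hk} => [|b u] hc hc2 hr2; exists (iter k mstep c').
Qed.

Definition store0 := Store (fun=> 0) (fun _ _ => false).

(** Two moves to the left of the first symbol skip the separator. The [K.+1] marks then written are
    the home mark and the marks of [K] registers with value 0, which is the tape of [store0]. *)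
Lemma boot w : w != [::] ->
  @at_instr K prog (2 * K + 8) (init (machine K prog) w) (0, store0, rev w).
Proof.
case: w => // b w _; set c0 := init _ _.
have hw ph o : ph < 17 -> o < B -> working K prog (0, ph, o).
  by move=> h ho; exact: working_code.
have e2 : iter 2 mstep c0 =
    (code (0, 15, 0), [::], None, None :: map Some (b :: w)).
  have e1 : mstep c0 = (code (0, 14, 0), [::], None, map Some (b :: w)).
    by rewrite -[c0]/(code (0, 13, 0), [::], Some b, map Some w) step_working ?hw.
  by rewrite iterS [iter 1 _ _]e1 step_working ?hw.
have h0 : leads 2 c0 (fun=> None) 0 (rev (b :: w)) (0, 15, 0).
  exists (iter 2 mstep c0); first by exists 2.
  exists [::], 0; rewrite e2 revK cats0; split=> // i.
  by rewrite nth_nil.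
pose F j z := if z < j then Some true else None : option bool.
have h1 j : j <= K.+1 -> leads (2 + j) c0 (F j) j (rev (b :: w)) (0, 15, j).
  elim: j => [|j IH] hj.
    by apply: leads_ext h0 _ _ => // z; rewrite /F ltn0.
  have hjB : j < B by rewrite /B; lia.
  have hd : mdelta K prog (0, 15, j) (F j j) = ((0, 15, j.+1), Some true, MLeft).
    rewrite /mdelta; have -> : j <= K by lia.
    by rewrite modn_small // -/B /B; lia.
  apply: leads_ext (leads_left (IH (ltnW hj)) isT isT hjB hd) _ _; first by lia.
  by move=> z; rewrite /set_cell /F ltnS [z <= j]leq_eqVlt; case: (z == j).
have hKB : K.+1 < B by rewrite /B; lia.
have hd : mdelta K prog (0, 15, K.+1) (F K.+1 K.+1) = ((0, 16, K.+1), F K.+1 K.+1, MStay).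
  by rewrite /mdelta ltnn.
have h2 := leads_ext (leads_stay (h1 _ (leqnn _)) isT isT hKB hd) (leqnn _) (@set_cell_id _ _).
have hF : F K.+1 =1 cell K store0.
  move=> z; rewrite /F {1}(divn_eq z K.+3) /cell /=.
  have hm : z %% K.+3 < K.+3 by rewrite ltn_pmod.
  move: (z %/ _) (z %% _) hm => i j hj.
  case: i => [|i]; first by case: j {hj} => //= j; rewrite ltnS; case: ifP.
  rewrite mulSn -addnA; set y := _ + (_ + _).
  have -> : (y < K.+1) = false by rewrite /y; lia.
  by case: j {hj y} => //= j; case: (j < K).
have hm : K.+1 = K.+1 %[mod B] by [].
have := leads_return h2 _ isT isT _; rewrite modn_small // => /(_ erefl) h3.
have hF' : home_marked K (F K.+1) by move=> y hy; rewrite hF (cell_home _ hy).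
by apply: leads_ext (h3 hF') _ hF; lia.
Qed.

Definition istep (st : istate) : istate := iexec (instr_at st.1.1) st.

Arguments istep : simpl never.

Lemma at_istep t c pc s u m : all (wf_instr K) prog ->
  @at_instr K prog t c (pc, s, u) -> pc < size prog ->
  (forall x, reg s x <= m) ->
  at_instr (t + icost K m (size u)) c (istep (pc, s, u)).
Proof.
move=> hall hl hpc hm.
have hwf : wf_instr K (instr_at pc) by move/(all_nthP (IHalt false)): hall; apply.
rewrite /istep /= -/(instr_at pc); move: hwf; rewrite /wf_instr.
case ei : (instr_at pc) => [x|x|b x|x y l|b x l|l|l1 l2 l3|b] /andP[/= hx hy].
- exact: leads_inc.
- exact: leads_zero.
- exact: leads_setm.
- exact: leads_lt.
- exact: leads_test.
- by apply: leads_weaken (leads_jmp ei hl hpc) _; rewrite /icost; lia.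
- have := leads_pop ei hl hpc; case: (u) => [|b u'] h; apply: leads_weaken h _; rewrite /icost; lia.
- by apply: leads_weaken hl _; lia.
Qed.

(** Outside the program the default instruction is [IHalt false], which [iexec] leaves in place. *)
Lemma istep_stuck st n : size prog <= st.1.1 -> iter n istep st = st.
Proof.
move=> h; elim: n => [|n IH] //; rewrite iterS IH /istep.
by rewrite /instr_at nth_default //; case: st h {IH} => [[pc s] u].
Qed.

(** One instruction raises a register by at most one, so the number of steps bounds the distance the
    head travels in each of them. *)
Lemma istep_bounds n w : let st := iter n istep (0, store0, w) in
  (forall x, reg st.1.2 x <= n) /\ size st.2 <= size w.
Proof.
elim: n => [|n [IH1 IH2]] //=; move: IH1 IH2.
case: (iter n istep _) => [[pc s] u] /= IH1 IH2; rewrite /istep /=.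
have hS x : reg s x <= n.+1 by apply: leqW.
case: (instr_at pc) => [x|x|b x|x y l|b x l|l|l1 l2 l3|b] //=.
- by split=> // y; case: ifP => // _; rewrite ltnS.
- by split=> // y; case: ifP.
- by case: u IH2 => [|b u] hu; split=> //=; apply: ltnW.
Qed.

Lemma run_halt n w pc s u b : all (wf_instr K) prog -> w != [::] ->
  iter n istep (0, store0, rev w) = (pc, s, u) ->
  pc < size prog -> instr_at pc = IHalt b ->
  forall t, 2 * K + 9 + n * icost K n (size w) <= t ->
  state_of (run (machine K prog) t w) =
    if b then accept (machine K prog) else reject (machine K prog).
Proof.
move=> hall hw hn hpc ei t ht.
(* Once outside the program the counter would stay there, contrary to [pc < size prog] at the
   end. *)
have hlt k : k <= n -> (iter k istep (0, store0, rev w)).1.1 < size prog.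
  move=> hk; rewrite ltnNge; apply/negP => hge.
  move: hn; rewrite -(subnK hk) iterD istep_stuck // => hn.
  by rewrite hn leqNgt hpc in hge.
have h k : k <= n -> @at_instr K prog (2 * K + 8 + k * icost K n (size w))
    (init (machine K prog) w) (iter k istep (0, store0, rev w)).
  elim: k => [|k IH] hk; first by rewrite addn0; apply: boot.
  have := IH (ltnW hk); have := hlt k (ltnW hk); have := istep_bounds k (rev w).
  rewrite iterS; case: (iter k istep _) => [[pc' s'] u'] /= [h1 h2] h3 h4.
  rewrite size_rev in h2.
  have := at_istep hall h4 h3 (m := n) (fun x => leq_trans (h1 x) (ltnW hk)).
  case: (istep _) => [[pc2 s2] u2] h5; apply: leads_weaken h5 _.
  rewrite mulSn -addnA leq_add2l addnC leq_add2r.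
  by rewrite /icost leq_add2r leq_add2l leq_mul2l h2 orbT.
have := h n (leqnn n); rewrite hn => hl.
have [c' [k hk ->] [l [e [ec _]]]] := leads_halt ei hl hpc.
rewrite /run -(subnK (leq_trans hk (leq_trans _ ht))); last by lia.
rewrite iterD ec /= ; move: (_ - k) => j.
have hst : forall j q l h rt,
   (q == accept (machine K prog)) || (q == reject (machine K prog)) ->
   iter j mstep (q, l, h, rt) = (q, l, h, rt).
  move=> {}j q l' h' rt hq; elim: j => [|j IH] //.
  by rewrite iterS IH /step hq.
by rewrite hst; case: (b); rewrite ?eqxx ?orbT.
Qed.

End InputAndRun.

(** * Structured programs *)

Inductive cmd :=
| CSkip
| CInc of nat
| CZero of nat
| CSet of bool & nat
| CSeq of cmd & cmd
| CLt of nat & nat & cmd & cmd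
| CTest of bool & nat & cmd & cmd
| CWhile of nat & cmd.

(* CWhile x c loops while register x is below register 0, which holds the
   input length; the last argument counts machine instructions. *)
Inductive exec : cmd -> store -> store -> nat -> Prop :=
| ExSkip s : exec CSkip s s 0
| ExInc x s : exec (CInc x) s (set_reg s x (reg s x).+1) 1
| ExZero x s : exec (CZero x) s (set_reg s x 0) 1
| ExSet b x s : exec (CSet b x) s (set_mem s b (reg s x)) 1
| ExSeq c1 c2 s1 s2 s3 t1 t2 :
    exec c1 s1 s2 t1 -> exec c2 s2 s3 t2 -> exec (CSeq c1 c2) s1 s3 (t1 + t2)
| ExLtT x y c1 c2 s s' t : y < x -> reg s x < reg s y ->
    exec c1 s s' t -> exec (CLt x y c1 c2) s s' t.+2
| ExLtF x y c1 c2 s s' t : y < x -> reg s y <= reg s x ->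
    exec c2 s s' t -> exec (CLt x y c1 c2) s s' t.+1
| ExTestT b x c1 c2 s s' t : bits s b (reg s x) ->
    exec c1 s s' t -> exec (CTest b x c1 c2) s s' t.+2
| ExTestF b x c1 c2 s s' t : ~~ bits s b (reg s x) ->
    exec c2 s s' t -> exec (CTest b x c1 c2) s s' t.+1
| ExWhileF x c s : 0 < x -> reg s 0 <= reg s x -> exec (CWhile x c) s s 1
| ExWhileT x c s1 s2 s3 t1 t2 : 0 < x -> reg s1 x < reg s1 0 ->
    exec c s1 s2 t1 -> exec (CWhile x c) s2 s3 t2 ->
    exec (CWhile x c) s1 s3 (t1.+2 + t2).

(** * Compilation of structured programs to jump code *)

Fixpoint code_size (c : cmd) : nat :=
  match c with
  | CSkip => 0
  | CInc _ | CZero _ | CSet _ _ => 1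
  | CSeq c1 c2 => code_size c1 + code_size c2
  | CLt _ _ c1 c2 | CTest _ _ c1 c2 => (code_size c1 + code_size c2).+2
  | CWhile _ c => (code_size c).+2
  end.

(* The simulation handles register comparisons only for y < x; comparisons
   violating this are never executed according to exec. *)
Definition compile_lt x y l := if y < x then ILt x y l else IHalt false.

Fixpoint compile (c : cmd) (pc : nat) : seq instr :=
  match c with
  | CSkip => [::]
  | CInc x => [:: IInc x]
  | CZero x => [:: IZero x]
  | CSet b x => [:: ISet b x]
  | CSeq c1 c2 => compile c1 pc ++ compile c2 (pc + code_size c1)
  | CLt x y c1 c2 =>
      compile_lt x y (pc.+2 + code_size c1) :: compile c1 pc.+1 ++
      IJmp (pc.+2 + code_size c1 + code_size c2) ::
      compile c2 (pc.+2 + code_size c1)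
  | CTest b x c1 c2 =>
      ITest b x (pc.+2 + code_size c1) :: compile c1 pc.+1 ++
      IJmp (pc.+2 + code_size c1 + code_size c2) ::
      compile c2 (pc.+2 + code_size c1)
  | CWhile x c =>
      compile_lt x 0 (pc.+2 + code_size c) :: compile c pc.+1 ++ [:: IJmp pc]
  end.

Lemma size_compile c pc : size (compile c pc) = code_size c.
Proof.
elim: c pc => //= [c1 IH1 c2 IH2|x y c1 IH1 c2 IH2|b x c1 IH1 c2 IH2|x c IH] pc;
  by rewrite !size_cat /= ?IH1 ?IH2 ?IH ?addnS ?addn0.
Qed.

Fixpoint max_reg (c : cmd) : nat :=
  match c with
  | CSkip => 0
  | CInc x | CZero x | CSet _ x => x
  | CSeq c1 c2 => maxn (max_reg c1) (max_reg c2)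
  | CLt x _ c1 c2 | CTest _ x c1 c2 => maxn x (maxn (max_reg c1) (max_reg c2))
  | CWhile x c => maxn x (max_reg c)
  end.

Lemma wf_compile K c pc : max_reg c <= K -> all (wf_instr K.+1) (compile c pc).
Proof.
have hlt x y l : x <= K -> wf_instr K.+1 (compile_lt x y l).
  by move=> hx; rewrite /compile_lt; case: ifP => h; rewrite /wf_instr /= ?h ?andbT.
elim: c pc => [|x|x|b x|c1 IH1 c2 IH2|x y c1 IH1 c2 IH2|b x c1 IH1 c2 IH2|x c IH] pc //=;
  rewrite ?geq_max ?all_cat /=.
- by rewrite /wf_instr /= ltnS => ->.
- by rewrite /wf_instr /= ltnS => ->.
- by rewrite /wf_instr /= ltnS => ->.
- by case/andP=> h1 h2; rewrite IH1 ?IH2.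
- by case/and3P=> h0 h1 h2; rewrite hlt ?IH1 ?IH2.
- by case/and3P=> h0 h1 h2; rewrite IH1 ?IH2 // /wf_instr /= ltnS h0.
- by case/andP=> h0 h1; rewrite hlt ?IH.
Qed.

Definition code_at (prog : seq instr) pc code :=
  exists p q, prog = p ++ code ++ q /\ size p = pc.

Lemma code_at_cat prog pc c1 c2 : code_at prog pc (c1 ++ c2) ->
  code_at prog pc c1 /\ code_at prog (pc + size c1) c2.
Proof.
move=> [p [q [-> <-]]]; split.
  by exists p, (c2 ++ q); rewrite -[(c1 ++ c2) ++ q]catA.
by exists (p ++ c1), q; rewrite !catA size_cat.
Qed.

Lemma code_at_cons prog pc i c : code_at prog pc (i :: c) ->
  nth (IHalt false) prog pc = i /\ code_at prog pc.+1 c.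
Proof.
rewrite -cat1s => /code_at_cat [[p [q [-> <-]]]]; rewrite addn1; split=> //.
by rewrite nth_cat ltnn subnn.
Qed.

(** By induction on the execution rather than on the command, because the remaining rounds of a loop
    are an execution of the same command at the same address. *)
Lemma compile_correct prog c s s' t u pc : exec c s s' t ->
  code_at prog pc (compile c pc) ->
  iter t (istep prog) (pc, s, u) = (pc + code_size c, s', u).
Proof.
move=> h; elim: h pc => {c s s' t}
  [s|x s|x s|b x s|c1 c2 s1 s2 s3 t1 t2 _ IH1 _ IH2
  |x y c1 c2 s s' t hyx hlt _ IH|x y c1 c2 s s' t hyx hle _ IH
  |b x c1 c2 s s' t hm _ IH|b x c1 c2 s s' t hm _ IH
  |x c s hx hle|x c s1 s2 s3 t1 t2 hx hlt _ IH1 _ IH2] pc hc.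
- by rewrite addn0.
- by have [e _] := code_at_cons hc; rewrite /= addn1 /istep /= e.
- by have [e _] := code_at_cons hc; rewrite /= addn1 /istep /= e.
- by have [e _] := code_at_cons hc; rewrite /= addn1 /istep /= e.
- have [h1 h2] := code_at_cat hc; rewrite size_compile in h2.
  by rewrite addnC iterD IH1 // IH2 // addnA.
- have [e h1] := code_at_cons hc; have [h2 h3] := code_at_cat h1.
  have [ej _] := code_at_cons h3; rewrite size_compile in ej.
  rewrite iterS iterSr {2}/istep /= e /compile_lt hyx /= hlt IH // /istep /= ej /=.
  by rewrite !addnS !addSn addnA.
- have [e h1] := code_at_cons hc; have [h2 h3] := code_at_cat h1.
  have [_ h4] := code_at_cons h3; rewrite size_compile in h4.
  rewrite iterSr {2}/istep /= e /compile_lt hyx /= ltnNge hle /= IH //.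
  by rewrite !addnS !addSn addnA.
- have [e h1] := code_at_cons hc; have [h2 h3] := code_at_cat h1.
  have [ej _] := code_at_cons h3; rewrite size_compile in ej.
  rewrite iterS iterSr {2}/istep /= e /= hm IH // /istep /= ej /=.
  by rewrite !addnS !addSn addnA.
- have [e h1] := code_at_cons hc; have [h2 h3] := code_at_cat h1.
  have [_ h4] := code_at_cons h3; rewrite size_compile in h4.
  rewrite iterSr {2}/istep /= e /= (negbTE hm) IH //.
  by rewrite !addnS !addSn addnA.
- have [e h1] := code_at_cons hc.
  by rewrite /= /istep /= e /compile_lt hx /= ltnNge hle !addnS !addSn.
- have [e h1] := code_at_cons hc; have [h2 h3] := code_at_cat h1.
  have [ej _] := code_at_cons h3; rewrite size_compile in ej.
  rewrite addnC iterD; have -> : iter t1.+2 (istep prog) (pc, s1, u) = (pc, s2, u).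
    by rewrite iterS iterSr {2}/istep /= e /compile_lt hx /= hlt IH1 // /istep /= ej.
  exact: IH2.
Qed.

(** A loop is charged for [N] rounds. Nothing in [exec] enforces this bound; it is asserted by
    [execs] and established for loops in [execs_for]. *)
Fixpoint cost (N : nat) (c : cmd) : nat :=
  match c with
  | CSkip => 0
  | CInc _ | CZero _ | CSet _ _ => 1
  | CSeq c1 c2 => cost N c1 + cost N c2
  | CLt _ _ c1 c2 | CTest _ _ c1 c2 => (cost N c1 + cost N c2).+2
  | CWhile _ c => (N * (cost N c).+2).+1
  end.

(** The base [n.+1] keeps powers monotone in the exponent at [n = 0] too, so sums need no case
    distinction. *)
Definition poly_bounded (f : nat -> nat) :=
  exists A D, forall n, f n <= A * n.+1 ^ D.

Lemma poly_const k : poly_bounded (fun=> k).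
Proof. by exists k, 0 => n; rewrite muln1. Qed.

Lemma poly_id : poly_bounded id.
Proof. by exists 1, 1 => n; rewrite mul1n expn1. Qed.

Lemma poly_le f g : (forall n, f n <= g n) -> poly_bounded g -> poly_bounded f.
Proof. by move=> h [A [D hg]]; exists A, D => n; apply: leq_trans (h n) (hg n). Qed.

Lemma poly_add f g : poly_bounded f -> poly_bounded g ->
  poly_bounded (fun n => f n + g n).
Proof.
move=> [A [D hf]] [A' [D' hg]]; exists (A + A'), (D + D') => n.
rewrite mulnDl leq_add //.
  by apply: leq_trans (hf n) _; rewrite leq_mul2l leq_pexp2l ?leq_addr ?orbT.
by apply: leq_trans (hg n) _; rewrite leq_mul2l leq_pexp2l ?leq_addl ?orbT.
Qed.

Lemma poly_mul f g : poly_bounded f -> poly_bounded g ->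
  poly_bounded (fun n => f n * g n).
Proof.
move=> [A [D hf]] [A' [D' hg]]; exists (A * A'), (D + D') => n.
by rewrite expnD mulnACA leq_mul.
Qed.

Lemma poly_cost c : poly_bounded (cost^~ c).
Proof.
elim: c => [|x|x|b x|c1 IH1 c2 IH2|x y c1 IH1 c2 IH2|b x c1 IH1 c2 IH2|x c IH] /=;
  try exact: poly_const.
- exact: poly_add.
- exact: poly_le (fun n => _) (poly_add (poly_const 2) (poly_add IH1 IH2)).
- exact: poly_le (fun n => _) (poly_add (poly_const 2) (poly_add IH1 IH2)).
- apply: poly_le (fun n => _) (poly_add (poly_const 1)
    (poly_mul poly_id (poly_add (poly_const 2) IH))) => //.
Qed.

(** Total correctness with the time bound built in, so that termination, result and running time
    follow from one set of rules. *)
Definition execs N c s (Q : store -> Prop) :=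
  exists s' t, [/\ exec c s s' t, t <= cost N c & Q s'].

Lemma execs_seq N c1 c2 s (Q Q' : store -> Prop) : execs N c1 s Q ->
  (forall s', Q s' -> execs N c2 s' Q') -> execs N (CSeq c1 c2) s Q'.
Proof.
move=> [s1 [t1 [h1 ht1 hQ]]] /(_ _ hQ) [s2 [t2 [h2 ht2 hQ']]].
exists s2, (t1 + t2); split=> //; first exact: ExSeq h1 h2.
exact: leq_add.
Qed.

Lemma execs_conseq N c s (Q Q' : store -> Prop) :
  execs N c s Q -> (forall s', Q s' -> Q' s') -> execs N c s Q'.
Proof. by move=> [s1 [t1 [h1 ht1 hQ]]] h; exists s1, t1; split=> //; apply: h. Qed.

Lemma execs_skip N s (Q : store -> Prop) : Q s -> execs N CSkip s Q.
Proof. by exists s, 0; split=> //; constructor. Qed.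

Lemma execs_inc N x s (Q : store -> Prop) :
  Q (set_reg s x (reg s x).+1) -> execs N (CInc x) s Q.
Proof. by move=> h; exists (set_reg s x (reg s x).+1), 1; split=> //; constructor. Qed.

Lemma execs_zero N x s (Q : store -> Prop) :
  Q (set_reg s x 0) -> execs N (CZero x) s Q.
Proof. by move=> h; exists (set_reg s x 0), 1; split=> //; constructor. Qed.

Lemma execs_set N b x s (Q : store -> Prop) :
  Q (set_mem s b (reg s x)) -> execs N (CSet b x) s Q.
Proof. by move=> h; exists (set_mem s b (reg s x)), 1; split=> //; constructor. Qed.

Lemma execs_lt N x y c1 c2 s (Q : store -> Prop) : y < x ->
  execs N (if reg s x < reg s y then c1 else c2) s Q ->
  execs N (CLt x y c1 c2) s Q.
Proof.
move=> hyx; case: ltnP => h [s' [t [h1 h2 h3]]].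
  by exists s', t.+2; split=> //; [exact: ExLtT | rewrite /= !ltnS (leq_trans h2) ?leq_addr].
exists s', t.+1; split=> //; first exact: ExLtF.
by rewrite /= ltnS (leq_trans h2) // ltnW // ltnS leq_addl.
Qed.

Lemma execs_test N b x c1 c2 s (Q : store -> Prop) :
  execs N (if bits s b (reg s x) then c1 else c2) s Q ->
  execs N (CTest b x c1 c2) s Q.
Proof.
case: ifP => h [s' [t [h1 h2 h3]]].
  by exists s', t.+2; split=> //; [exact: ExTestT | rewrite /= !ltnS (leq_trans h2) ?leq_addr].
exists s', t.+1; split=> //; first by apply: ExTestF => //; rewrite h.
by rewrite /= ltnS (leq_trans h2) // ltnW // ltnS leq_addl.
Qed.

Definition CFor x c := CSeq (CZero x) (CWhile x (CSeq c (CInc x))).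

(** The body must preserve the counter and register 0, which forces exactly [N] rounds. The
    invariant for [i.+1] speaks of the store whose counter is already incremented. *)
Lemma execs_for N (I : nat -> store -> Prop) x c s : 0 < x -> reg s 0 = N ->
  I 0 (set_reg s x 0) ->
  (forall i s, i < N -> I i s -> reg s x = i -> reg s 0 = N ->
     execs N c s (fun s' =>
       [/\ reg s' x = i, reg s' 0 = N & I i.+1 (set_reg s' x i.+1)])) ->
  execs N (CFor x c) s (fun s' => [/\ I N s', reg s' 0 = N & reg s' x = N]).
Proof.
move=> hx h0 hI hstep.
have hw k i s1 : i + k = N -> I i s1 -> reg s1 x = i -> reg s1 0 = N ->
    exists s' t, [/\ exec (CWhile x (CSeq c (CInc x))) s1 s' t,
       t <= (k * (cost N c).+3).+1, I N s', reg s' 0 = N & reg s' x = N].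
  elim: k i s1 => [|k IH] i s1 hik hI1 hx1 h01.
    rewrite addn0 in hik; rewrite hik in hI1 hx1; exists s1, 1; split=> //.
    by apply: ExWhileF; rewrite // h01 hx1.
  have hi : i < N by lia.
  have [s2 [t [h1 h2 [h3 h4 h5]]]] := hstep _ _ hi hI1 hx1 h01.
  have hS : i.+1 + k = N by lia.
  have hx0 : (0 == x) = false by rewrite ltn_eqF.
  have := IH _ _ hS h5; rewrite /= eqxx hx0 => /(_ erefl h4) [s3 [t' [h6 h7 h8 h9 h10]]].
  exists s3, ((t + 1).+2 + t'); split=> //; last by rewrite mulSn; lia.
  apply: ExWhileT h6 => //; first by rewrite hx1 h01.
  apply: ExSeq h1 _; rewrite -h3; exact: ExInc.
have hx0 : (0 == x) = false by rewrite ltn_eqF.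
have [||s' [t [h1 h2 h3 h4 h5]]] := hw N 0 (set_reg s x 0) (add0n _) hI.
- by rewrite /= eqxx.
- by rewrite /= hx0.
exists s', (1 + t); split=> //; first by apply: ExSeq h1; constructor.
by rewrite /= addn1; lia.
Qed.

(** * Terms *)

(* A term adds its value to the target register a, using the registers from D
   on as scratch space. *)
Definition term := nat -> nat -> cmd.

Definition ZERO : term := fun _ _ => CSkip.
Definition ONE : term := fun _ a => CInc a.
Definition ADD (t1 t2 : term) : term := fun D a => CSeq (t1 D a) (t2 D a).
(** There is no copy instruction: a value is transferred by counting, with one increment in each of
    the [N] rounds whose index lies below it. This needs the value to be at most [N], and [x] to be
    below [D]. *)
Definition VAR (x : nat) : term := fun D a => CFor D (CLt D x (CInc a) CSkip).
(** The bound variable is passed to [F] as the term reading the loop counter, so function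
    abstraction provides the binders of the language. Terms add to their target, so repeating the
    body sums up. *)
Definition SUM (F : term -> term) : term :=
  fun D a => CFor D (F (VAR D) D.+1 a).
(** The right operand goes to [D] and the left one to [D.+1], as [CLt x y] requires [y < x]. *)
Definition IFLT (t1 t2 t3 t4 : term) : term := fun D a =>
  CSeq (CSeq (CZero D) (t2 D.+1 D))
    (CSeq (CSeq (CZero D.+1) (t1 D.+2 D.+1))
       (CLt D.+1 D (t3 D.+2 a) (t4 D.+2 a))).
Definition BIT (t t1 t2 : term) : term := fun D a =>
  CSeq (CSeq (CZero D) (t D.+1 D)) (CTest false D (t1 D.+1 a) (t2 D.+1 a)).

Definition TOP : term := VAR 0.
Definition IF (b t1 t2 : term) : term := IFLT ZERO b t1 t2.
Definition LT (t1 t2 : term) : term := IFLT t1 t2 ONE ZERO.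
Definition EQ (t1 t2 : term) : term := IFLT t1 t2 ZERO (IFLT t2 t1 ZERO ONE).
Definition AND (b1 b2 : term) : term := IF b1 b2 ZERO.
Definition OR (b1 b2 : term) : term := IF b1 ONE b2.
Definition NOT (b : term) : term := IF b ZERO ONE.
Definition CONST (n : nat) : term := iter n (ADD ONE) ZERO.
Definition MUL (t1 t2 : term) : term := SUM (fun x => IFLT x t1 t2 ZERO).
Definition SUMLT (t : term) (F : term -> term) : term :=
  SUM (fun x => IFLT x t (F x) ZERO).

Section Terms.
Variables (N : nat) (inb : nat -> bool).

Definition ctx := seq (nat * nat).

(** [D] separates live registers from scratch space. The target is live but not in the context,
    since accumulating into it would change a variable being read. *)
Definition ok (G : ctx) D a (s : store) :=
  [/\ 0 < a < D, reg s 0 = N, (forall i, bits s false i = inb i) &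
      forall x v, (x, v) \in G -> [/\ x < D, x != a, reg s x = v & v <= N]].

Definition added D a (s : store) v (s' : store) :=
  [/\ reg s' a = reg s a + v,
      (forall x, x < D -> x != a -> reg s' x = reg s x) & bits s' = bits s].

Definition tspec (G : ctx) (t : term) v :=
  forall D a s, ok G D a s -> execs N (t D a) s (added D a s v).

Lemma ok_scratch G D a s a' s' D' : ok G D a s -> D <= a' < D' ->
  (forall x, x < D -> x != a -> reg s' x = reg s x) -> bits s' = bits s ->
  ok G D' a' s'.
Proof.
move=> [/andP[h1 h2] h3 h4 h5] /andP[h6 h7] h8 h9; split.
- lia.
- by rewrite h8 ?h3 //; lia.
- by rewrite h9.
- move=> x v /h5 [h h' h'' h''']; split=> //; try lia.
  by rewrite h8.
Qed.

Lemma ok_same G D a s s' D' : ok G D a s -> D <= D' ->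
  (forall x, x < D -> x != a -> reg s' x = reg s x) -> bits s' = bits s ->
  ok G D' a s'.
Proof.
move=> [/andP[h1 h2] h3 h4 h5] h6 h8 h9; split.
- lia.
- by rewrite h8 ?h3 //; lia.
- by rewrite h9.
- move=> x v /h5 [h h' h'' h''']; split=> //; try lia.
  by rewrite h8.
Qed.

Lemma tspec_weak G t v y : tspec G t v -> tspec (y :: G) t v.
Proof.
move=> h D a s [h1 h2 h3 h4]; apply: h; split=> // x w hx.
by apply: h4; rewrite inE hx orbT.
Qed.

Lemma tspec_zero G : tspec G ZERO 0.
Proof. by move=> D a s hok; apply: execs_skip; split=> //; rewrite addn0. Qed.

Lemma tspec_one G : tspec G ONE 1.
Proof.
move=> D a s [h1 h2 _ _]; apply: execs_inc; split=> //=; first by rewrite eqxx addn1.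
by move=> x hx /negbTE ->.
Qed.

Lemma tspec_add G t1 t2 v1 v2 : tspec G t1 v1 -> tspec G t2 v2 ->
  tspec G (ADD t1 t2) (v1 + v2).
Proof.
move=> h1 h2 D a s hok; apply: execs_seq (h1 _ _ _ hok) _ => s1 [e1 e2 e3].
apply: execs_conseq (h2 _ _ _ (ok_same hok (leqnn _) e2 e3)) _ => s2 [e4 e5 e6].
by split=> [|x hx hxa|]; rewrite ?e4 ?e1 ?addnA // ?e5 ?e2 // e6 e3.
Qed.

Lemma tspec_var_reg G x D a s v : ok G D a s -> x < D -> x != a -> reg s x = v ->
  v <= N -> execs N (VAR x D a) s (added D a s v).
Proof.
move=> hok hx hxa hv hvN; have [/andP[ha0 haD] h0 _ _] := hok.
have hD : 0 < D by lia.
pose I i s' := added D a s (minn i v) s'.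
apply: execs_conseq (@execs_for N I D _ s hD h0 _ _) _.
- split=> //=; first by rewrite ltn_eqF // min0n addn0.
  by move=> y hy _; rewrite ltn_eqF.
- move=> i s1 hi [e1 e2 e3] hD1 h01; apply: execs_lt => //.
  rewrite hD1 (e2 x) // hv; case: ltnP => hiv.
    apply: execs_inc; split=> /=; rewrite ?(gtn_eqF haD) ?(ltn_eqF ha0) //.
    split=> [|y hy hya|] //=; rewrite ?(ltn_eqF haD) ?eqxx ?e1; first by lia.
    by rewrite (ltn_eqF hy) (negbTE hya) e2.
  apply: execs_skip; split=> //; split=> [|y hy hya|] //=.
    by rewrite (ltn_eqF haD) e1; lia.
  by rewrite (ltn_eqF hy) e2.
- by move=> s' [[e1 e2 e3] _ _]; split=> //; rewrite e1; lia.
Qed.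

Lemma tspec_var G x v : (x, v) \in G -> tspec G (VAR x) v.
Proof.
move=> hG D a s hok; have [_ _ _ h] := hok; have [h1 h2 h3 h4] := h _ _ hG.
exact: (tspec_var_reg hok).
Qed.

Lemma tspec_top G : tspec G TOP N.
Proof.
move=> D a s hok; have [/andP[h1 h2] h0 _ _] := hok.
by apply: (tspec_var_reg hok) => //; lia.
Qed.

Lemma tspec_sum G (F : term -> term) f :
  (forall x i, i < N -> tspec ((x, i) :: G) (F (VAR x)) (f i)) ->
  tspec G (SUM F) (\sum_(i < N) f i).
Proof.
move=> h D a s hok; have [/andP[ha0 haD] h0 hb hG] := hok.
have hD : 0 < D by lia.
pose I i s' := added D a s (\sum_(j < i) f j) s'.
apply: execs_conseq (@execs_for N I D _ s hD h0 _ _) _.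
- split=> //=; first by rewrite (ltn_eqF haD) big_ord0 addn0.
  by move=> y hy _; rewrite ltn_eqF.
- move=> i s1 hi [e1 e2 e3] hD1 h01.
  have hok1 : ok ((D, i) :: G) D.+1 a s1.
    split=> //; [lia | by rewrite e3 | move=> x v; rewrite inE => /orP[/eqP[-> ->]|]].
      by split=> //; lia.
    by move/hG=> [? ? ? ?]; split=> //; [lia | rewrite e2].
  apply: execs_conseq (h _ _ hi _ _ _ hok1) _ => s2 [e4 e5 e6]; split.
  + by rewrite e5 ?hD1 // neq_ltn haD orbT.
  + by rewrite e5 ?h01 // neq_ltn ha0.
  split=> [|y hy hya|] //=; last by rewrite e6.
    by rewrite (ltn_eqF haD) e4 e1 big_ord_recr /= addnA.
  by rewrite (ltn_eqF hy) e5 ?e2 // ltnW.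
- by move=> s' [].
Qed.

Lemma execs_temp G t v D a s D' : ok G D a s -> D <= D' -> tspec G t v ->
  execs N (CSeq (CZero D') (t D'.+1 D')) s (fun s' =>
    [/\ reg s' D' = v, (forall x, x < D' -> reg s' x = reg s x) & bits s' = bits s]).
Proof.
move=> hok hD h; apply: (execs_seq (Q := fun s' => s' = set_reg s D' 0)).
  exact: execs_zero.
move=> _ ->.
have hok' : ok G D'.+1 D' (set_reg s D' 0).
  apply: ok_scratch hok _ _ _ => //=; first by rewrite hD ltnS leqnn.
  by move=> x hx _; rewrite ltn_eqF // (leq_trans hx).
apply: execs_conseq (h _ _ _ hok') _ => s' [e1 e2 e3]; split=> //.
  by rewrite e1 /= eqxx.
by move=> x hx; rewrite e2 /= ?(ltn_eqF hx) // ltnW.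
Qed.

(** A branch has to be correct only when it is taken. Guards can thus protect lookups at indices for
    which the instance has no entry. *)
Lemma tspec_iflt G t1 t2 t3 t4 v1 v2 v3 v4 :
  tspec G t1 v1 -> tspec G t2 v2 -> (v1 < v2 -> tspec G t3 v3) ->
  (v2 <= v1 -> tspec G t4 v4) ->
  tspec G (IFLT t1 t2 t3 t4) (if v1 < v2 then v3 else v4).
Proof.
move=> h1 h2 h3 h4 D a s hok; have [/andP[ha0 haD] _ _ _] := hok.
apply: execs_seq (execs_temp hok (leqnn D) h2) _ => s1 [e1 e2 e3].
have hok1 : ok G D.+1 a s1.
  by apply: ok_same hok _ _ e3 => // x hx _; apply: e2.
apply: execs_seq (execs_temp hok1 (leqnn D.+1) h1) _ => s2 [e4 e5 e6].
have hok2 : ok G D.+2 a s2.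
  by apply: ok_same hok1 _ _ e6 => // x hx _; apply: e5.
apply: execs_lt => //; rewrite e4 (e5 D) // e1.
have h : tspec G (if v1 < v2 then t3 else t4) (if v1 < v2 then v3 else v4).
  by case: ltnP.
have -> : (if v1 < v2 then t3 D.+2 a else t4 D.+2 a) = (if v1 < v2 then t3 else t4) D.+2 a.
  by case: ifP.
apply: execs_conseq (h _ _ _ hok2) _ => s3 [e7 e8 e9].
split=> [|x hx hxa|]; last by rewrite e9 e6.
  by rewrite e7 e5 ?e2 // ltnW.
by rewrite e8 ?e5 ?e2 //; lia.
Qed.

Lemma tspec_bit G t t1 t2 v v1 v2 :
  tspec G t v -> tspec G t1 v1 -> tspec G t2 v2 ->
  tspec G (BIT t t1 t2) (if inb v then v1 else v2).
Proof.
move=> h h1 h2 D a s hok; have [/andP[ha0 haD] _ hb _] := hok.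
apply: execs_seq (execs_temp hok (leqnn D) h) _ => s1 [e1 e2 e3].
have hok1 : ok G D.+1 a s1.
  by apply: ok_same hok _ _ e3 => // x hx _; apply: e2.
apply: execs_test; rewrite e1 e3 hb.
have h' : tspec G (if inb v then t1 else t2) (if inb v then v1 else v2).
  by case: ifP.
have -> : (if inb v then t1 D.+1 a else t2 D.+1 a) = (if inb v then t1 else t2) D.+1 a.
  by case: ifP.
apply: execs_conseq (h' _ _ _ hok1) _ => s3 [e7 e8 e9].
split=> [|x hx hxa|]; last by rewrite e9 e3.
  by rewrite e7 e2.
by rewrite e8 ?e2 //; lia.
Qed.

Lemma tspec_eqv G t v v' : tspec G t v -> v = v' -> tspec G t v'.
Proof. by move=> h <-. Qed.

Lemma tspec_const G n : tspec G (CONST n) n.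
Proof.
elim: n => [|n IH]; first exact: tspec_zero.
exact: (tspec_add (@tspec_one G) IH).
Qed.

Lemma tspec_lt G t1 t2 v1 v2 : tspec G t1 v1 -> tspec G t2 v2 ->
  tspec G (LT t1 t2) (v1 < v2).
Proof.
move=> h1 h2; apply: (tspec_eqv (v := if v1 < v2 then 1 else 0)).
  by apply: tspec_iflt => // _; [apply: tspec_one | apply: tspec_zero].
by case: ifP.
Qed.

Lemma tspec_if G (b : bool) tb t1 t2 v1 v2 : tspec G tb b ->
  (b -> tspec G t1 v1) -> (~~ b -> tspec G t2 v2) ->
  tspec G (IF tb t1 t2) (if b then v1 else v2).
Proof.
move=> h1 h2 h3; apply: (tspec_eqv (v := if 0 < b then v1 else v2)).
  by apply: tspec_iflt (@tspec_zero G) h1 _ _; case: b h2 h3 => h2 h3 // _; auto.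
by case: b {h1 h2 h3}.
Qed.

Lemma tspec_eq G t1 t2 v1 v2 : tspec G t1 v1 -> tspec G t2 v2 ->
  tspec G (EQ t1 t2) (v1 == v2).
Proof.
move=> h1 h2; apply: (tspec_eqv (v := if v1 < v2 then 0 else if v2 < v1 then 0 else 1)).
  apply: tspec_iflt => // _; first exact: tspec_zero.
  by apply: tspec_iflt => // _; [apply: tspec_zero | apply: tspec_one].
by case: ltngtP.
Qed.

Lemma tspec_and G (b1 b2 : bool) t1 t2 : tspec G t1 b1 ->
  (b1 -> tspec G t2 b2) -> tspec G (AND t1 t2) (b1 && b2).
Proof.
move=> h1 h2; apply: (tspec_eqv (v := if b1 then nat_of_bool b2 else 0)).
  by apply: tspec_if => // _; apply: tspec_zero.
by case: b1 {h1 h2}.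
Qed.

Lemma tspec_or G (b1 b2 : bool) t1 t2 : tspec G t1 b1 ->
  (~~ b1 -> tspec G t2 b2) -> tspec G (OR t1 t2) (b1 || b2).
Proof.
move=> h1 h2; apply: (tspec_eqv (v := if b1 then 1 else nat_of_bool b2)).
  by apply: tspec_if => // _; apply: tspec_one.
by case: b1 {h1 h2}.
Qed.

Lemma tspec_not G (b : bool) t : tspec G t b -> tspec G (NOT t) (~~ b).
Proof.
move=> h; apply: (tspec_eqv (v := if b then 0 else 1)).
  by apply: tspec_if => // _; [apply: tspec_zero | apply: tspec_one].
by case: b {h}.
Qed.

Lemma tspec_sumlt G t (F : term -> term) n f : tspec G t n -> n <= N ->
  (forall x i, i < n -> tspec ((x, i) :: G) (F (VAR x)) (f i)) ->
  tspec G (SUMLT t F) (\sum_(i < n) f i).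
Proof.
move=> ht hn h; apply: (tspec_eqv (v := \sum_(i < N) if i < n then f i else 0)).
  apply: (@tspec_sum G _ (fun i => if i < n then f i else 0)) => x i hi.
  apply: tspec_iflt.
  - by apply: tspec_var; rewrite mem_head.
  - exact: tspec_weak.
  - exact: h.
  - by move=> _; apply: tspec_zero.
by rewrite -big_mkcond /= (big_ord_widen_cond _ xpredT _ hn).
Qed.

Lemma tspec_mul G t1 t2 v1 v2 : tspec G t1 v1 -> v1 <= N -> tspec G t2 v2 ->
  tspec G (MUL t1 t2) (v1 * v2).
Proof.
move=> h1 hle h2; apply: (tspec_eqv (v := \sum_(i < v1) v2)).
  apply: tspec_sumlt => // x i hi; exact: tspec_weak.
by rewrite sum_nat_const card_ord mulnC.
Qed.

End Terms.

(** * Exploration of a monotone graph *)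

Definition horner (N : nat) (x : seq nat) := foldl (fun acc v => acc * N + v) 0 x.

Lemma horner_rcons N x v : horner N (rcons x v) = horner N x * N + v.
Proof. by rewrite /horner foldl_rcons. Qed.

Lemma horner_lt N x : all (fun v => v < N) x -> horner N x < N ^ size x.
Proof.
elim/last_ind: x => [|x v IH] //; rewrite all_rcons size_rcons => /andP[hv /IH h].
rewrite horner_rcons expnSr; apply: (@leq_trans ((horner N x).+1 * N)).
  by rewrite mulSn addnC ltn_add2r.
by rewrite leq_mul2r h orbT.
Qed.

Lemma horner_inj N x y : size x = size y -> all (fun v => v < N) x ->
  all (fun v => v < N) y -> horner N x = horner N y -> x = y.
Proof.
elim/last_ind: x y => [|x v IH]; elim/last_ind => [|y w _] //; rewrite ?size_rcons //.
move=> [hs]; rewrite !all_rcons !horner_rcons => /andP[hv hx] /andP[hw hy] e.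
have N0 : 0 < N by apply: leq_ltn_trans hv.
have := congr1 (divn^~ N) e; have := congr1 (modn^~ N) e.
rewrite !modnMDl !modn_small // !divnMDl // !divn_small // !addn0 => -> /IH -> //.
Qed.

Lemma horner_zero N k : horner N (nseq k 0) = 0.
Proof. by elim: k => //= k IH; rewrite /horner /= mul0n. Qed.

Lemma horner_cons N v x : horner N (v :: x) = v * N ^ size x + horner N x.
Proof.
elim/last_ind: x => [|x w IH]; first by rewrite /horner /= muln1 addn0.
rewrite -rcons_cons !horner_rcons IH size_rcons expnSr mulnDl; lia.
Qed.

(** The sum of a constant over the [N] loop indices multiplies the accumulator by [N]. *)
Definition HORNER (ts : seq term) : term :=
  foldl (fun acc t => ADD (SUM (fun=> acc)) t) ZERO ts.

Fixpoint tspecs N inb (G : ctx) (ts : seq term) (vs : seq nat) : Prop :=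
  match ts, vs with
  | [::], [::] => True
  | t :: ts, v :: vs => tspec N inb G t v /\ tspecs N inb G ts vs
  | _, _ => False
  end.

Lemma tspec_horner N inb G ts vs : tspecs N inb G ts vs ->
  tspec N inb G (HORNER ts) (horner N vs).
Proof.
rewrite /HORNER /horner; have := @tspec_zero N inb G; move: ZERO 0.
elim: ts vs => [|t ts IH] [|v vs] //= t0 v0 h0 [h1 h2]; apply: IH => //.
apply: tspec_add => //; apply: (tspec_eqv (v := \sum_(i < N) v0)).
  by apply: tspec_sum => x i _; apply: tspec_weak.
by rewrite sum_nat_const card_ord mulnC.
Qed.

(* A nondeterministic move on digit vectors: a guard and a successor. *)
Definition move_term : Type := (term * seq term)%type.
Definition digit_move : Type := ((seq nat -> bool) * (seq nat -> seq nat))%type.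

Section Program.
Variable K : nat.

Definition try_move (m : move_term) : cmd :=
  CSeq (CSeq (CZero K.+2) (m.1 K.+3 K.+2))
    (CSeq (CZero K.+3)
      (CLt K.+3 K.+2
        (CSeq (CSeq (CZero K.+2) (HORNER m.2 K.+3 K.+2)) (CSet true K.+2))
        CSkip)).

Definition try_moves (ms : seq move_term) : cmd :=
  foldr (fun m c => CSeq (try_move m) c) CSkip ms.

(* Register 1 holds the address of the digit vector in registers 2, ..., K.+1,
   which the loops enumerate in lexicographic order. *)
Definition visit (ms : seq move_term) : cmd :=
  CSeq (CTest true 1 (try_moves ms) CSkip) (CInc 1).

Definition explore (ms : seq move_term) : cmd :=
  CSeq (CSet true 1) (foldr CFor (visit ms) (iota 2 K)).

Variables (N : nat) (inb : nat -> bool).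

Definition digit_ctx (x : seq nat) : ctx := zip (iota 2 (size x)) x.

Definition is_vector (x : seq nat) := (size x == K) && all (fun v => v < N) x.

Definition move_spec (mt : move_term) (m : digit_move) := forall x, is_vector x ->
  tspec N inb (digit_ctx x) mt.1 (m.1 x) /\
  (m.1 x -> tspecs N inb (digit_ctx x) mt.2 (m.2 x)).

Fixpoint moves_spec (mts : seq move_term) (ms : seq digit_move) : Prop :=
  match mts, ms with
  | [::], [::] => True
  | mt :: mts, m :: ms => move_spec mt m /\ moves_spec mts ms
  | _, _ => False
  end.

(* The digits of x are in their registers, those of the inner loops being
   unconstrained. *)
Definition holds (x : seq nat) (s : store) :=
  [/\ reg s 0 = N, (forall i, bits s false i = inb i) &
      forall i, i < size x -> reg s (i + 2) = nth 0 x i].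

Lemma digit_ctxP x y v : (y, v) \in digit_ctx x ->
  exists2 i, i < size x & y = i + 2 /\ v = nth 0 x i.
Proof.
move=> h; have hs : size (iota 2 (size x)) = size x by rewrite size_iota.
have := nth_index (0, 0) h; have : index (y, v) (digit_ctx x) < size x.
  by rewrite -[X in _ < X](_ : size (digit_ctx x) = _) ?index_mem // size_zip hs minnn.
move: (index _ _) => i hi; rewrite nth_zip // => -[<- <-].
by exists i => //; rewrite nth_iota // addnC.
Qed.

Lemma ok_digits x s : is_vector x -> holds x s -> ok N inb (digit_ctx x) K.+2 1 s.
Proof.
move=> /andP[/eqP hs hx] [h1 h2 h3]; split=> // y v /digit_ctxP[i hi [-> ->]].
rewrite h3 //; split=> //; try lia.
by move/(all_nthP 0): hx => /(_ _ hi) /ltnW.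
Qed.

Definition same_regs (s s' : store) :=
  [/\ forall x, x < K.+2 -> reg s' x = reg s x & bits s' false =1 bits s false].

Lemma same_holds x s s' : size x <= K -> holds x s -> same_regs s s' -> holds x s'.
Proof.
move=> hs [h1 h2 h3] [h4 h5]; split=> [|i|i hi]; first by rewrite h4.
  by rewrite h5.
by rewrite h4 ?h3 //; lia.
Qed.

Lemma try_move_spec mt m x s : move_spec mt m -> is_vector x -> holds x s ->
  execs N (try_move mt) s (fun s' => same_regs s s' /\
    forall b, bits s' true b = bits s true b || m.1 x && (b == horner N (m.2 x))).
Proof.
move=> hm hx hs; have [hg ht] := hm x hx.
have hK : size x <= K by case/andP: hx => /eqP ->.
apply: execs_seq (execs_temp (ok_digits hx hs) (leqnn _) hg) _ => s1 [e1 e2 e3].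
apply: (execs_seq (Q := fun s' => s' = set_reg s1 K.+3 0)); first exact: execs_zero.
move=> _ ->; set s2 := set_reg _ _ _.
have hsame : same_regs s s2.
  by split=> [y hy|i] /=; rewrite ?e3 // ltn_eqF ?e2 // ltnW.
apply: execs_lt => //; rewrite /= eqxx ltn_eqF // e1.
case hmx : (m.1 x); rewrite hmx in ht; last first.
  by apply: execs_skip; split=> // b; rewrite /= e3 orbF.
have hok2 := ok_digits hx (same_holds hK hs hsame).
apply: execs_seq (execs_temp hok2 (leqnn _) (tspec_horner (ht isT))) _ => s3 [e4 e5 e6].
apply: execs_set; split=> [|b]; last by rewrite /= e4 e6 e3.
case: hsame => h1 h2; split=> [y hy|i] /=; first by rewrite e5 ?h1.
by rewrite e6 h2 orbF.
Qed.

Lemma same_trans s1 s2 s3 : same_regs s1 s2 -> same_regs s2 s3 -> same_regs s1 s3.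
Proof.
move=> [h1 h2] [h3 h4]; split=> [x hx|i]; first by rewrite h3 ?h1.
by rewrite h4 h2.
Qed.

Lemma try_moves_spec mts ms x s : moves_spec mts ms -> is_vector x -> holds x s ->
  execs N (try_moves mts) s (fun s' => same_regs s s' /\
    forall b, bits s' true b =
      bits s true b || has (fun m => m.1 x && (b == horner N (m.2 x))) ms).
Proof.
move=> + hx; elim: mts ms s => [|mt mts IH] [|m ms] s //=.
  by move=> _ hs; apply: execs_skip; split=> // b; rewrite orbF.
have hK : size x <= K by case/andP: hx => /eqP ->.
move=> [h1 h2] hs; apply: execs_seq (try_move_spec h1 hx hs) _ => s1 [h3 h4].
apply: execs_conseq (IH _ _ h2 (same_holds hK hs h3)) _ => s2 [h5 h6].
split; first exact: same_trans h5.
by move=> b; rewrite h6 h4 orbA.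
Qed.

Variables (mts : seq move_term) (ms : seq digit_move).
Hypothesis hspec : moves_spec mts ms.

Let no_move : digit_move := (fun=> false, id).

(** A move to a smaller address sets a bit that the pass has already left behind. Completeness is
    therefore claimed only along increasing moves, whereas soundness covers all moves. *)
Inductive increasing_path : seq nat -> Prop :=
| IncStart : increasing_path (nseq K 0)
| IncStep x o : increasing_path x -> is_vector x -> (nth no_move ms o).1 x ->
    horner N x < horner N ((nth no_move ms o).2 x) ->
    increasing_path ((nth no_move ms o).2 x).

(** An invariant of all moves, increasing or not. Members that are not digit vectors must lie beyond
    the table, so that inside it an address determines the vector. *)
Variable Inv : seq nat -> Prop.
Hypothesis Inv_start : Inv (nseq K 0).
Hypothesis Inv_step : forall x o, Inv x -> is_vector x ->
  (nth no_move ms o).1 x -> Inv ((nth no_move ms o).2 x).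
Hypothesis Inv_vector : forall x, Inv x -> is_vector x \/ N ^ K <= horner N x.

(** The state of the table once all addresses below [a] are visited: the second clause is soundness,
    the third completeness for the visited part. *)
Definition table_inv (a : nat) (T : nat -> bool) :=
  [/\ T 0, (forall b, T b -> exists2 x, Inv x & horner N x = b) &
      forall x o, increasing_path x -> is_vector x -> (nth no_move ms o).1 x ->
        horner N x < horner N ((nth no_move ms o).2 x) -> horner N x < a ->
        T (horner N ((nth no_move ms o).2 x))].

(** The predecessor of [x] on the path has a smaller address, hence has been visited already. *)
Lemma path_marked a T x : table_inv a T -> increasing_path x -> horner N x <= a ->
  T (horner N x).
Proof.
move=> [h1 _ h2] h ha; case: h ha => [|{}x o hp hv hg hlt] ha.
  by rewrite horner_zero.
by apply: h2 => //; apply: leq_trans ha.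
Qed.

Lemma vector_inj x y : is_vector x -> is_vector y -> horner N x = horner N y -> x = y.
Proof.
by move=> /andP[/eqP h1 h2] /andP[/eqP h3 h4]; apply: horner_inj; rewrite ?h1.
Qed.

Lemma vector_lt x : is_vector x -> horner N x < N ^ K.
Proof. by case/andP=> /eqP <-; apply: horner_lt. Qed.

Lemma table_step x (T T' : nat -> bool) : is_vector x -> table_inv (horner N x) T ->
  (forall b, T' b = T b ||
     T (horner N x) && has (fun m => m.1 x && (b == horner N (m.2 x))) ms) ->
  table_inv (horner N x).+1 T'.
Proof.
move=> hx hT hT'; have [h1 h2 h3] := hT; split; first by rewrite hT' h1.
  move=> b; rewrite hT' => /orP[/h2 //|/andP[/h2 [y hy ey] /(has_nthP no_move)[o _]]].
  case/andP=> hg /eqP ->.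
  (* The mark was set for some invariant vector with this address; the address lies inside the
     table, so that vector is [x], and its moves are the ones just tried. *)
  have e : y = x.
    apply: vector_inj => //; case: (Inv_vector hy) => //.
    by rewrite ey leqNgt vector_lt.
  by subst y; exists ((nth no_move ms o).2 x) => //; apply: Inv_step.
move=> y o hp hy hg hlt; rewrite ltnS leq_eqVlt hT' => /orP[/eqP e|hya]; last first.
  by rewrite h3.
have {}e : y = x by apply: vector_inj.
subst y; apply/orP; right; rewrite (path_marked hT hp) //=.
apply/(has_nthP no_move); exists o; last by rewrite hg eqxx.
by rewrite ltnNge; apply: contraTN hg => ho; rewrite nth_default.
Qed.

Lemma visit_spec x s : is_vector x -> holds x s -> reg s 1 = horner N x ->
  table_inv (horner N x) (bits s true) ->
  execs N (visit mts) s (fun s' => [/\ reg s' 1 = (horner N x).+1,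
    table_inv (horner N x).+1 (bits s' true),
    forall y, y < K.+2 -> y != 1 -> reg s' y = reg s y &
    bits s' false =1 bits s false]).
Proof.
move=> hx hs h1 hT.
pose Q s' := same_regs s s' /\ table_inv (horner N x).+1 (bits s' true).
apply: (execs_seq (Q := Q)).
  apply: execs_test; rewrite h1; case: ifP => hTx.
    apply: execs_conseq (try_moves_spec hspec hx hs) _ => s' [e1 e2]; split=> //.
    by apply: table_step hT _ => // b; rewrite e2 hTx.
  apply: execs_skip; split=> //; apply: table_step hT _ => // b.
  by rewrite hTx orbF.
move=> s' [[e1 e2] e3]; apply: execs_inc; split=> //=.
  by rewrite e1 ?h1.
by move=> y hy /negbTE ->; rewrite e1.
Qed.

(** The inner [k] loops enumerate the extensions of the prefix [p]. Their addresses are the [N ^ k]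
    consecutive numbers from [horner N p * N ^ k] on, so incrementing register 1 keeps pace with the
    digits. *)
Lemma loops_spec k p s : size p + k = K -> all (fun v => v < N) p -> holds p s ->
  reg s 1 = horner N p * N ^ k -> table_inv (horner N p * N ^ k) (bits s true) ->
  execs N (foldr CFor (visit mts) (iota (size p + 2) k)) s (fun s' =>
    [/\ reg s' 1 = (horner N p).+1 * N ^ k,
        table_inv ((horner N p).+1 * N ^ k) (bits s' true),
        forall y, y < size p + 2 -> y != 1 -> reg s' y = reg s y &
        bits s' false =1 bits s false]).
Proof.
elim: k p s => [|k IH] p s hk hp hs h1 hT.
  rewrite /= !muln1 in h1 hT *; rewrite addn0 in hk.
  have hx : is_vector p by rewrite /is_vector hk eqxx.
  apply: execs_conseq (visit_spec hx hs h1 hT) _ => s' [e1 e2 e3 e4]; split=> //.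
  by move=> y hy hy1; apply: e3 => //; lia.
have [h0 hb hr] := hs.
have hx0 : 0 < size p + 2 by rewrite addn2.
pose I i s' := [/\ reg s' 1 = (horner N p * N + i) * N ^ k,
        table_inv ((horner N p * N + i) * N ^ k) (bits s' true),
        forall y, y < size p + 2 -> y != 1 -> reg s' y = reg s y &
        bits s' false =1 bits s false].
have ek i : (horner N p * N + i) * N ^ k = horner N p * N ^ k.+1 + i * N ^ k.
  by rewrite mulnDl -mulnA -expnS.
have hne y : y < size p + 2 -> (y == size p + 2) = false by move/ltn_eqF.
have h1lt : 1 < size p + 2 by rewrite addn2.
apply: execs_conseq (@execs_for N I (size p + 2) _ s hx0 h0 _ _) _.
- split=> //; rewrite ?ek ?addn0 //=; first by rewrite hne.
  by move=> y hy _; rewrite hne.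
- move=> i s1 hi [e1 e2 e3 e4] hx1 h01.
  have hs1 : holds (rcons p i) s1.
    split=> // [j|j]; first by rewrite e4.
    rewrite size_rcons ltnS nth_rcons => hj; case: ltngtP hj => // [hj|->] _ //.
    by rewrite e3 ?hr //; lia.
  have hp1 : all (fun v => v < N) (rcons p i) by rewrite all_rcons hi.
  have hk1 : size (rcons p i) + k = K by rewrite size_rcons addSnnS.
  have := IH (rcons p i) s1 hk1 hp1 hs1; rewrite !horner_rcons size_rcons addSn.
  move=> /(_ e1 e2) h; apply: execs_conseq h _ => s2 [e5 e6 e7 e8].
  split; first by rewrite e7 ?hx1 //; lia.
    by rewrite e7 ?h01.
  split=> //=; first by rewrite hne // e5 addnS.
  + by rewrite addnS.
  + by move=> y hy hy1; rewrite hne // e7 ?e3 // ltnW.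
  + by move=> j; rewrite e8 e4.
move=> s' [[e1 e2 e3 e4] _ _].
have eK : (horner N p).+1 * N ^ k.+1 = (horner N p * N + N) * N ^ k.
  by rewrite expnS mulnA mulSn [N + _]addnC.
by split; rewrite ?eK.
Qed.

Lemma explore_spec s : reg s 0 = N -> reg s 1 = 0 ->
  (forall i, bits s false i = inb i) -> (forall i, bits s true i = false) ->
  execs N (explore mts) s (fun s' => reg s' 1 = N ^ K /\
    ((forall x, increasing_path x -> N ^ K = horner N x -> bits s' true (N ^ K)) /\
     (bits s' true (N ^ K) -> exists2 x, Inv x & horner N x = N ^ K))).
Proof.
move=> h0 h1 hb ht.
apply: (execs_seq (Q := fun s' => s' = set_mem s true 0)).
  by apply: execs_set; rewrite h1.
move=> _ ->; set s1 := set_mem _ _ _.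
have hs1 : holds [::] s1.
  by split=> // i; rewrite /s1 /= orbF hb.
have hT : table_inv 0 (bits s1 true).
  split=> [|b|//]; first by rewrite /= orbT.
  rewrite /= ht /= => /eqP ->; exists (nseq K 0) => //.
  exact: horner_zero.
have := @loops_spec K [::] s1 erefl isT hs1; rewrite mul0n => /(_ h1 hT) h.
apply: execs_conseq h _ => s' [e1 e2 _ _]; rewrite mul1n in e1 e2; split=> //; split.
  by move=> x hp e; rewrite e; apply: (path_marked e2 hp); rewrite -e.
by case: e2 => _ h _ /h.
Qed.

End Program.

(** * From programs to decision procedures *)

Section Decision.
Variable c : cmd.

Definition num_regs := (maxn (max_reg c) 1).+1.

(* The first four instructions move the input, last symbol first, to the bit
   array "false" and its length to register 0; the answer of c is the entry of
   the other bit array at the address in register 1. *)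
Definition decision_prog : seq instr :=
  [:: IPop 1 2 4; ISet false 0; IInc 0; IJmp 0] ++ compile c 4 ++
  [:: ITest true 1 (code_size c + 6); IHalt true; IHalt false].

Lemma wf_decision_prog : all (wf_instr num_regs) decision_prog.
Proof.
rewrite /decision_prog !all_cat wf_compile ?leq_maxl //= /wf_instr /= /num_regs.
by rewrite !ltnS leq_maxr.
Qed.

(** A symbol [true] takes four instructions, a symbol [false] three, and the last pop finds the
    input empty. *)
Lemma load u s : exists k s', [/\ k <= 4 * size u + 1,
  iter k (istep decision_prog) (0, s, u) = (4, s', [::]),
  reg s' 0 = reg s 0 + size u,
  (forall x, x != 0 -> reg s' x = reg s x) &
  bits s' true =1 bits s true /\
  forall i, bits s' false i =
    bits s false i || (reg s 0 <= i) && nth false u (i - reg s 0)].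
Proof.
elim: u s => [|b u IH] s.
  exists 1, s; split=> //; first by rewrite addn0.
  by split=> // i; rewrite nth_nil andbF orbF.
pose s1 := if b then set_mem s false (reg s 0) else s.
pose s2 := set_reg s1 0 (reg s1 0).+1.
have e1 : exists2 k, k <= 4 & iter k (istep decision_prog) (0, s, b :: u) = (0, s2, u).
  by rewrite /s2 /s1; case: (b); [exists 4 | exists 3].
have [k1 hk1 {}e1] := e1; have [k2 [s3 [hk2 e2 h1 h2 [h3 h4]]]] := IH s2.
have r1 : reg s1 0 = reg s 0 by rewrite /s1; case: (b).
exists (k2 + k1), s3; split.
- by rewrite /=; lia.
- by rewrite iterD e1.
- by rewrite h1 /= r1 addSnnS.
- by move=> x hx; rewrite h2 //= (negbTE hx) /s1; case: (b).
split=> i.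
  by rewrite h3 /= /s1; case: (b) => //=; rewrite orbF.
rewrite h4 /= r1 /s1; case: (ltngtP (reg s 0) i) => hi.
- rewrite (_ : i - reg s 0 = (i - (reg s 0).+1).+1) /=; last by lia.
  by case: (b) => //=; rewrite gtn_eqF ?orbF.
- by case: (b) => //=; rewrite ltn_eqF ?orbF.
- by rewrite -hi subnn /=; case: (b); rewrite /= ?eqxx ?orbF ?orbT.
Qed.

Definition steps_bound N := 4 * N + 1 + (cost N c + 2).

Definition time_bound N :=
  2 * num_regs + 9 +
  steps_bound N * (4 * num_regs.+3 * (steps_bound N + 3) + 2 * N + 20).

Lemma poly_time_bound : poly_bounded time_bound.
Proof.
have hs : poly_bounded steps_bound.
  apply: poly_add (poly_add (poly_mul (poly_const 4) poly_id) (poly_const 1)) _.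
  exact: poly_add (poly_cost c) (poly_const 2).
apply: poly_add (poly_const _) (poly_mul hs _).
apply: poly_add (poly_add _ (poly_mul (poly_const 2) poly_id)) (poly_const 20).
exact: poly_mul (poly_const _) (poly_add hs (poly_const 3)).
Qed.

Lemma decision_correct w (b : bool) : w != [::] ->
  (forall s, reg s 0 = size w -> (forall x, x != 0 -> reg s x = 0) ->
     (forall i, bits s false i = nth false (rev w) i) ->
     (forall i, bits s true i = false) ->
     execs (size w) c s (fun s' => bits s' true (reg s' 1) = b)) ->
  forall t, time_bound (size w) <= t ->
  state_of (run (machine num_regs decision_prog) t w) =
    if b then accept (machine num_regs decision_prog)
    else reject (machine num_regs decision_prog).
Proof.
move=> hw hc t ht.
have [k [s [hk e1 h1 h2 [h3 h4]]]] := load (rev w) store0.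
rewrite size_rev in hk h1.
have [|x hx|i|i|s' [tc [hexec htc hb]]] := hc s; rewrite ?h1 ?h3 //.
- by rewrite h2.
- by rewrite h4 /= subn0.
have hcode : code_at decision_prog 4 (compile c 4).
  by exists [:: IPop 1 2 4; ISet false 0; IInc 0; IJmp 0]; eexists.
have e2 := compile_correct [::] hexec hcode.
have hend j : j < 3 -> nth (IHalt false) decision_prog (4 + code_size c + j) =
    nth (IHalt false) [:: ITest true 1 (code_size c + 6); IHalt true; IHalt false] j.
  move=> hj; rewrite -addnA; transitivity (nth (IHalt false) (compile c 4 ++
    [:: ITest true 1 (code_size c + 6); IHalt true; IHalt false]) (code_size c + j)) => //.
  by rewrite nth_cat size_compile ltnNge leq_addr addKn.
have hsize : size decision_prog = code_size c + 7.
  by rewrite /decision_prog !size_cat size_compile /=; lia.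
have e3 : iter (1 + (tc + k)) (istep decision_prog) (0, store0, rev w) =
   (if b then (4 + code_size c).+1 else code_size c + 6, s', [::]).
  have e4 := hend 0 isT; rewrite addn0 in e4; rewrite iterD iterD e1 e2.
  transitivity (iexec (nth (IHalt false) decision_prog (4 + code_size c))
    (4 + code_size c, s', [::])) => //.
  by rewrite e4 /= hb; case: (b).
have hn : 1 + (tc + k) <= steps_bound (size w).
  apply: leq_trans (leq_add (leqnn 1) (leq_add htc hk)) _; rewrite /steps_bound.
  by move: (size w) (cost _ c) => N C; lia.
apply: (run_halt wf_decision_prog hw e3).
- by rewrite hsize; case: (b); lia.
- case: (b); first by have := hend 1 isT; rewrite addn1.
  by have := hend 2 isT; rewrite (_ : 4 + _ + 2 = code_size c + 6) //; lia.
apply: leq_trans ht; rewrite /time_bound leq_add2l leq_mul //.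
by rewrite /icost !leq_add2r leq_mul2l leq_add2r hn orbT.
Qed.

End Decision.

(** * The sweep along the axis *)

(** Digits after the first difference do not matter: moves are increasing even when the vote index
    is reset and the window counters shift. *)
Lemma horner_lex N p a b s t : a < b -> size s = size t ->
  all (fun v => v < N) s -> horner N (p ++ a :: s) < horner N (p ++ b :: t).
Proof.
move=> hab hst hs; elim: p => [|c p IH] /=.
  rewrite !horner_cons hst; have := horner_lt hs; rewrite hst => h.
  have : a.+1 * N ^ size t <= b * N ^ size t by rewrite leq_mul2r hab orbT.
  by rewrite mulSn; lia.
by rewrite !horner_cons !size_cat /= hst ltn_add2l.
Qed.

Lemma sum_insert U (T P : nat -> bool) u : u < U -> ~~ T u ->
  \sum_(v < U) ((T v || (v == u :> nat)) && P v) = \sum_(v < U) (T v && P v) + P u.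
Proof.
move=> hu hT; rewrite (bigD1 (Ordinal hu)) //= eqxx orbT /=.
rewrite [in RHS](bigD1 (Ordinal hu)) //= (negbTE hT) /= add0n addnC; congr (_ + _).
apply: eq_bigr => v hv; congr (nat_of_bool (_ && _)).
by rewrite (_ : (v == u :> nat) = false) ?orbF //; apply: negbTE; apply: contra hv.
Qed.

Lemma sum_bool_le U (T : nat -> bool) : \sum_(v < U) T v <= U.
Proof.
rewrite -[X in _ <= X]card_ord -sum1_card; apply: leq_sum => v _.
exact: leq_b1.
Qed.

Section Sweep.
Variables (n q r U R : nat) (A : nat -> nat -> bool) (S : nat -> nat).

(** The near interval is half-open, from [q - r] to [q + r - 1], so its positions are the [2 * r]
    values [q + i - r], and the counter with index [r] belongs to [q]. *)
Definition far z := ~~ ((q <= z + r) && (z < q + r)).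
Definition far_appr u z := far z && A u z.
Local Notation F := far_appr.

(* Axis position j is the first far position approved by vote u, or j = n if
   there is none. *)
Definition starts_at u j :=
  (\sum_(z < j) F u z == 0) && ((j == n) || F u j).

Definition dim := 3 + (2 * r + r).

Definition vec (k j u : nat) (f g : nat -> nat) : seq nat :=
  [:: k, j, u & mkseq f (2 * r) ++ mkseq g r].

Definition near_digit (x : seq nat) i := nth 0 x (3 + i).
Definition win_digit (x : seq nat) i := nth 0 x (3 + (2 * r + i)).

(** The first two cases are indices off the axis. Under truncated subtraction those on the left are
    aliases of position 0, so their counters say nothing about a position of their own. *)
Definition check_near (x : seq nat) i :=
  [|| q + i < r, n <= q + i - r, i == r |
      S (q + i - r) + near_digit x i < S q + nth 0 x 0].

(** The leading entry [N] is not a digit: the vector has value [N ^ dim] and is never expanded. *)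
Definition accept_vec N := N :: nseq dim.-1 0.

(* A digit vector consists of the guessed number k of added votes, the axis
   position j and vote u under consideration, the numbers of approvals that the
   votes selected so far give to the 2r positions around q, and the numbers
   they give to the far ones among the positions j, ..., j + r - 1. *)
Definition sweep_moves N : seq digit_move :=
  [:: (fun x => [&& nth 0 x 1 == 0, nth 0 x 2 == 0 & nth 0 x 0 < R],
       fun x => vec (nth 0 x 0).+1 (nth 0 x 1) (nth 0 x 2) (near_digit x) (win_digit x));
      (fun x => nth 0 x 2 < U,
       fun x => vec (nth 0 x 0) (nth 0 x 1) (nth 0 x 2).+1 (near_digit x) (win_digit x));
      (fun x => [&& nth 0 x 2 < U, A (nth 0 x 2) q & starts_at (nth 0 x 2) (nth 0 x 1)],
       fun x => vec (nth 0 x 0) (nth 0 x 1) (nth 0 x 2).+1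
         (fun i => near_digit x i + A (nth 0 x 2) (q + i - r))
         (fun i => win_digit x i + F (nth 0 x 2) (nth 0 x 1 + i)));
      (fun x => [&& nth 0 x 2 == U, nth 0 x 1 < n &
                 ~~ far (nth 0 x 1) || (S (nth 0 x 1) + win_digit x 0 < S q + nth 0 x 0)],
       fun x => vec (nth 0 x 0) (nth 0 x 1).+1 0 (near_digit x)
         (fun i => win_digit x i.+1));
      (fun x => [&& nth 0 x 2 == U, nth 0 x 1 == n, near_digit x r == nth 0 x 0 &
                 \sum_(i < 2 * r) ~~ check_near x i == 0],
       fun=> accept_vec N)].

Definition approvals (T : nat -> bool) z := \sum_(v < U) (T v && A v z).

Definition solution (T : nat -> bool) :=
  [/\ forall v, T v -> v < U /\ A v q, \sum_(v < U) T v <= R &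
      forall z, z < n -> z != q -> S z + approvals T z < S q + \sum_(v < U) T v].

Lemma size_vec k j u f g : size (vec k j u f g) = dim.
Proof. by rewrite /vec /= size_cat !size_mkseq. Qed.

Lemma near_vec k j u f g i : i < 2 * r -> near_digit (vec k j u f g) i = f i.
Proof. by move=> hi; rewrite /near_digit /= nth_cat size_mkseq hi nth_mkseq. Qed.

Lemma win_vec k j u f g i : i < r -> win_digit (vec k j u f g) i = g i.
Proof.
move=> hi; rewrite /win_digit /= add0n nth_cat size_mkseq ltnNge leq_addr /= addKn.
by rewrite nth_mkseq.
Qed.

Lemma win_over x : size x = dim -> win_digit x r = 0.
Proof. by move=> hs; rewrite /win_digit nth_default // hs. Qed.

Lemma vec_digits x : size x = dim ->
  x = vec (nth 0 x 0) (nth 0 x 1) (nth 0 x 2) (near_digit x) (win_digit x).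
Proof.
case: x => [|k [|j [|u x]]] // [hs]; rewrite /vec /=; congr [:: _, _, _ & _].
apply: (@eq_from_nth _ 0) => [|i hi]; first by rewrite size_cat !size_mkseq hs.
rewrite nth_cat size_mkseq; case: ltnP => h; first by rewrite nth_mkseq.
rewrite nth_mkseq /win_digit /=; first by rewrite subnKC.
by rewrite hs /dim in hi; lia.
Qed.

Lemma starts_at_before u j z : starts_at u j -> z < j -> F u z = false.
Proof.
case/andP; rewrite sum_nat_eq0 => /forallP h _ hz.
by have := h (Ordinal hz); rewrite /= eqb0 => /negbTE.
Qed.

Lemma starts_at_uniq u j j' : j <= n -> starts_at u j -> starts_at u j' -> j' < j -> False.
Proof.
move=> hj h /andP[_ h'] hlt; have := starts_at_before h hlt.
by case/orP: h' => [/eqP e|->] //; lia.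
Qed.

Definition start_of u := find (F u) (iota 0 n).

Lemma start_of_le u : start_of u <= n.
Proof. by have := find_size (F u) (iota 0 n); rewrite size_iota. Qed.

Lemma starts_atP u : starts_at u (start_of u).
Proof.
rewrite /starts_at sum_nat_eq0; apply/andP; split.
  apply/forallP => -[z hz] /=; rewrite eqb0; apply/negbT.
  have := before_find 0 hz; rewrite nth_iota ?add0n //.
  exact: leq_trans hz (start_of_le u).
case: (boolP (has (F u) (iota 0 n))) => h.
  have := nth_find 0 h; move: h; rewrite has_find size_iota => h.
  by rewrite nth_iota // add0n => ->; rewrite orbT.
by move: h; rewrite has_find size_iota -leqNgt eqn_leq start_of_le => ->.
Qed.

Lemma far_neq z : 0 < r -> far z -> z != q.
Proof. by move=> r_gt0; apply: contraNneq => ->; rewrite leq_addr -[X in X < _]addn0 ltn_add2l. Qed.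

Lemma nseq_vec : nseq dim 0 = vec 0 0 0 (fun=> 0) (fun=> 0).
Proof.
rewrite /vec /dim; congr [:: _, _, _ & _]; apply: (@eq_from_nth _ 0) => [|i].
  by rewrite size_cat !size_mkseq size_nseq.
rewrite size_nseq nth_nseq nth_cat size_mkseq => hi; rewrite hi.
by case: ltnP => h; rewrite nth_mkseq //; lia.
Qed.

Lemma approvals_insert T u z : u < U -> ~~ T u ->
  approvals (fun v => T v || (v == u)) z = approvals T z + A u z.
Proof. by move=> hu hT; apply: (sum_insert (fun v => A v z)). Qed.

(** * Soundness of the sweep: reachable vectors describe partial selections *)

Section Soundness.
Variable N : nat.
Hypotheses (n_lt : n < N) (U_lt : U < N) (R_lt : R < N).

(** Each selected vote was decided at its own start, before the current position and index; this
    prevents selecting a vote twice and confines its far approvals. The inequalities use the guess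
    [k], which is compared with the size of [T] only on acceptance. *)
Definition partial (T : nat -> bool) (x : seq nat) :=
  let k := nth 0 x 0 in let j := nth 0 x 1 in let u := nth 0 x 2 in
  [/\ size x = dim, [/\ k <= R, j <= n & u <= U],
      forall v, T v -> [/\ v < U, A v q &
        exists2 j', starts_at v j' & j' < j \/ j' = j /\ v < u],
      (forall i, i < 2 * r -> near_digit x i = approvals T (q + i - r)) /\
      (forall i, i < r -> win_digit x i = \sum_(v < U) (T v && F v (j + i))) &
      forall z, z < j -> far z -> S z + approvals T z < S q + k].

Definition sweep_inv (x : seq nat) :=
  (x = accept_vec N /\ exists T, solution T) \/ exists T, partial T x.

Lemma digits_lt T x : partial T x -> is_vector dim N x.
Proof.
move=> [hs [hk hj hu] _ [hnear hwin] _]; rewrite /is_vector hs eqxx /=.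
rewrite (vec_digits hs) /vec /= all_cat; apply/and5P; split; try lia.
  apply/(all_nthP 0) => i; rewrite size_mkseq => hi; rewrite nth_mkseq // hnear //.
  exact: leq_ltn_trans (@sum_bool_le U (fun v => T v && A v _)) U_lt.
apply/(all_nthP 0) => i; rewrite size_mkseq => hi; rewrite nth_mkseq // hwin //.
exact: leq_ltn_trans (@sum_bool_le U (fun v => T v && F v _)) U_lt.
Qed.

Lemma sweep_inv_vector x : sweep_inv x -> is_vector dim N x \/ N ^ dim <= horner N x.
Proof.
case=> [[-> _]|[T /digits_lt]]; last by left.
by right; rewrite /accept_vec horner_cons size_nseq -expnS; apply: leq_addr.
Qed.

Lemma sweep_inv_start : sweep_inv (nseq dim 0).
Proof.
right; exists (fun=> false); rewrite nseq_vec; split=> //; first exact: size_vec.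
split=> i hi; first by rewrite near_vec // /approvals big1.
by rewrite win_vec // big1.
Qed.

Hypothesis r_gt0 : 0 < r.
Hypothesis window : forall u x y, u < U -> A u q -> F u x -> F u y -> y < x + r.

Lemma sweep_inv_step x o : sweep_inv x -> is_vector dim N x ->
  (nth (fun=> false, id) (sweep_moves N) o).1 x ->
  sweep_inv ((nth (fun=> false, id) (sweep_moves N) o).2 x).
Proof.
case=> [[-> _] /andP[_ /andP[]]|[T hp] _]; first by rewrite ltnn.
have [hs [hk hj hu] hT [hnear hwin] hcheck] := hp.
case: o => [|[|[|[|[|o]]]]] /=; last by rewrite nth_nil.
- case/and3P=> hj0 hu0 hkR; right; exists T; split=> //; first exact: size_vec.
  + by split=> i hi; rewrite ?near_vec ?win_vec ?hnear ?hwin.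
  + by move=> z /=; rewrite (eqP hj0).
- move=> huU; right; exists T; split=> //=; first exact: size_vec.
  + move=> v /hT[h1 h2 [j' h3 h4]]; split=> //; exists j' => //.
    by case: h4 => [|[h5 h6]]; [left | right; split=> //; apply: ltnW].
  + by split=> i hi; rewrite ?near_vec ?win_vec ?hnear ?hwin.
- case/and3P=> huU huq hst; set u := nth 0 x 2 in hu huU huq hst hT *.
  set j := nth 0 x 1 in hj hst hT hwin hcheck *.
  (* Were [u] already selected, its unique start would be [j], and its index would be smaller than
     itself. *)
  have hTu : ~~ T u.
    apply/negP => /hT[_ _ [j' h1 [h2|[_]]]]; last by rewrite ltnn.
    exact: starts_at_uniq hj hst h1 h2.
  right; exists (fun v => T v || (v == u)); split=> //=; first exact: size_vec.
  + move=> v /orP[/hT[h1 h2 [j' h3 h4]]|/eqP ->].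
      split=> //; exists j' => //.
      by case: h4 => [|[h5 h6]]; [left | right; split=> //; apply: ltnW].
    by split=> //; exists j => //; right.
  + split=> i hi; first by rewrite near_vec // approvals_insert // hnear.
    by rewrite win_vec // (sum_insert (fun v => F v (j + i))) // hwin.
  (* The new vote has no far approval left of [j], so the tests already passed remain valid. *)
  + move=> z hz hfz; rewrite approvals_insert //.
    have := starts_at_before hst hz; rewrite /F hfz /= => ->.
    by rewrite addn0; apply: hcheck.
- case/and3P=> /eqP huU hjn hch; set j := nth 0 x 1 in hj hjn hch hT hwin hcheck *.
  right; exists T; split=> //=; first exact: size_vec.
  + move=> v /hT[h1 h2 [j' h3 h4]]; split=> //; exists j' => //; left.
    by case: h4 => [|[-> _]] //; apply: leqW.
  + split=> i hi; first by rewrite near_vec // hnear.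
    rewrite win_vec //; case: (ltnP i.+1 r) => hir.
      by rewrite hwin //; apply: eq_bigr => v _; rewrite addSnnS.
    (* Position [j + r] enters the window with count 0: a selected vote has its first far approval
       at [j] or earlier, and [window] keeps its other ones less than [r] beyond that. *)
    have {}hir : i.+1 = r by lia.
    rewrite hir win_over // big1 // => v _; apply/eqP; rewrite eqb0.
    apply/negP => /andP[/hT[h1 h2 [j' h3 h4]] h5].
    have h6 : F v j'.
      by case/andP: h3 => _ /orP[/eqP e|//]; case: h4 => [|[]]; lia.
    have := window h1 h2 h6 h5; case: h4 => [|[]]; lia.
  + move=> z; rewrite ltnS leq_eqVlt => /orP[/eqP ->|]; last exact: hcheck.
    move=> hfj; move: hch; rewrite hfj /= hwin // addn0.
    by rewrite /F hfj.
- case/and4P=> /eqP huU /eqP hjn /eqP hkr; rewrite sum_nat_eq0 => /forallP hall.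
  left; split=> //; exists T.
  (* All selected votes approve [q], so the counter of [q] is their number; the guard equates it
     with the guess. *)
  have hTk : \sum_(v < U) T v = nth 0 x 0.
    rewrite -hkr hnear ?addnK; last lia.
    by apply: eq_bigr => v _; case hTv : (T v) => //=; have [_ -> _] := hT _ hTv.
  split; rewrite ?hTk //; first by move=> v /hT[].
  move=> z hz hzq; case hf : (far z); first by apply: hcheck; rewrite ?hjn.
  move/negbFE: hf => /andP[h1 h2]; have hi : z + r - q < 2 * r by lia.
  have := hall (Ordinal hi); rewrite eqb0 negbK /check_near /=.
  have -> : q + (z + r - q) = z + r by lia.
  rewrite addnK ltnNge leq_addl /= leqNgt hz /= hnear //.
  have -> : q + (z + r - q) - r = z by lia.
  by case/orP=> [|//]; move: hzq => /eqP; lia.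
Qed.

End Soundness.

(** * Completeness of the sweep: a solution yields an increasing path *)

Section Completeness.
Variables (N : nat) (T : nat -> bool).
Hypotheses (n_lt : n < N) (U_lt : U < N) (R_lt : R < N).
Hypothesis T_sol : solution T.
Hypothesis r_gt0 : 0 < r.
Hypothesis window : forall u x y, u < U -> A u q -> F u x -> F u y -> y < x + r.

Let k := \sum_(v < U) T v.

(** The canonical run decides votes in the lexicographic order of start and index. *)
Definition before j u v := (start_of v < j) || (start_of v == j) && (v < u).

Definition stage j u :=
  vec k j u (fun i => approvals (fun v => T v && before j u v) (q + i - r))
    (fun i => \sum_(v < U) ((T v && before j u v) && F v (j + i))).

Local Notation path := (increasing_path dim N (sweep_moves N)).

Lemma path_move o x y : path x -> is_vector dim N x ->
  (nth (fun=> false, id) (sweep_moves N) o).1 x ->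
  y = (nth (fun=> false, id) (sweep_moves N) o).2 x ->
  horner N x < horner N y -> path y.
Proof. by move=> h1 h2 h3 -> h4; apply: IncStep. Qed.

Lemma k_le : k <= R. Proof. by case: T_sol. Qed.

Lemma is_vector_vec k' j u f g : k' < N -> j < N -> u < N ->
  (forall i, i < 2 * r -> f i < N) -> (forall i, i < r -> g i < N) ->
  is_vector dim N (vec k' j u f g).
Proof.
move=> h1 h2 h3 hf hg; rewrite /is_vector size_vec eqxx /= h1 h2 h3 all_cat /=.
by apply/andP; split; apply/(all_nthP 0) => i; rewrite size_mkseq => hi;
  rewrite nth_mkseq; auto.
Qed.

Lemma stage_vector j u : j <= n -> u <= U -> is_vector dim N (stage j u).
Proof.
move=> hj hu; apply: is_vector_vec; try lia.
- exact: leq_ltn_trans k_le R_lt.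
- move=> i _; apply: leq_ltn_trans U_lt.
  exact: (@sum_bool_le U (fun v => (T v && before j u v) && A v (q + i - r))).
- move=> i _; apply: leq_ltn_trans U_lt.
  exact: (@sum_bool_le U (fun v => (T v && before j u v) && F v (j + i))).
Qed.

Lemma eq_vec k' j u f g f' g' : (forall i, i < 2 * r -> f i = f' i) ->
  (forall i, i < r -> g i = g' i) -> vec k' j u f g = vec k' j u f' g'.
Proof.
move=> hf hg; rewrite /vec; congr [:: _, _, _ & _ ++ _].
  by apply/eq_in_map => i; rewrite mem_iota => /andP[_]; apply: hf.
by apply/eq_in_map => i; rewrite mem_iota => /andP[_]; apply: hg.
Qed.

Lemma vec_tail k' j u f g : is_vector dim N (vec k' j u f g) ->
  all (fun v => v < N) (mkseq f (2 * r) ++ mkseq g r).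
Proof. by case/andP=> _ /and4P[]. Qed.

Lemma size_tail (f g f' g' : nat -> nat) : size (mkseq f (2 * r) ++ mkseq g r) =
  size (mkseq f' (2 * r) ++ mkseq g' r).
Proof. by rewrite !size_cat !size_mkseq. Qed.

Lemma path_start k' : k' <= k -> path (vec k' 0 0 (fun=> 0) (fun=> 0)).
Proof.
elim: k' => [|k' IH] hk'; first by rewrite -nseq_vec; constructor.
have kR := k_le; have hp := IH (ltnW hk').
have hv : is_vector dim N (vec k' 0 0 (fun=> 0) (fun=> 0)).
  by apply: is_vector_vec => //; lia.
have e : vec k'.+1 0 0 (fun=> 0) (fun=> 0) =
    (nth (fun=> false, id) (sweep_moves N) 0).2 (vec k' 0 0 (fun=> 0) (fun=> 0)).
  by apply: eq_vec => i hi; rewrite ?near_vec ?win_vec.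
apply: (path_move hp hv _ e) => /=; first lia.
apply: (@horner_lex N [::]) => //=.
by case/andP: hv => _ /andP[].
Qed.

(** A vote of [T] is selected only at its start; at all other positions the skipping move is used
    for it. *)
Lemma path_next j u : j <= n -> u < U -> path (stage j u) -> path (stage j u.+1).
Proof.
move=> hj hu hp; have hv := stage_vector hj (ltnW hu).
case hsel : (T u && (start_of u == j)).
  have [hTu /eqP hst] := andP hsel.
  have hbef v : T v && before j u.+1 v = (T v && before j u v) || (v == u).
    rewrite /before ltnS [v <= u]leq_eqVlt; case: (eqVneq v u) => [->|_] /=.
      by rewrite hTu hst eqxx ?andbT !orbT.
    by rewrite orbF.
  have hnot : ~~ (T u && before j u u) by rewrite /before hst !ltnn !andbF.
  have e : stage j u.+1 = (nth (fun=> false, id) (sweep_moves N) 2).2 (stage j u).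
    apply: eq_vec => i hi; rewrite ?near_vec ?win_vec // ?[nth _ _ _]/=.
      rewrite -(@approvals_insert (fun v => T v && before j u v)) //.
      by apply: eq_bigr => v _; rewrite hbef.
    have := @sum_insert U (fun v => T v && before j u v) (fun v => F v (j + i)) u hu hnot.
    by move=> /= <-; apply: eq_bigr => v _; rewrite hbef.
  apply: (path_move hp hv _ e) => /=.
    case: T_sol => /(_ _ hTu)[_ ->] _ _; rewrite hu -[X in starts_at _ X]hst.
    exact: starts_atP.
  by apply: (@horner_lex N [:: k; j]) => //; [apply: size_tail | apply: vec_tail hv].
have hbef v : T v && before j u.+1 v = T v && before j u v.
  rewrite /before ltnS [v <= u]leq_eqVlt; case: (eqVneq v u) => [->|_] //=.
  by rewrite andbT ltnn andbF orbF andb_orr hsel orbF.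
have e : stage j u.+1 = (nth (fun=> false, id) (sweep_moves N) 1).2 (stage j u).
  apply: eq_vec => i hi; rewrite ?near_vec ?win_vec //.
    by apply: eq_bigr => v _; rewrite hbef.
  by apply: eq_bigr => v _; rewrite hbef.
apply: (path_move hp hv _ e) => //=.
by apply: (@horner_lex N [:: k; j]) => //; [apply: size_tail | apply: vec_tail hv].
Qed.

Lemma approvals_sub (P : nat -> bool) z :
  approvals (fun v => T v && P v) z <= approvals T z.
Proof. by apply: leq_sum => v _; case: (T v); case: (P v); case: (A v z). Qed.

Lemma path_shift j : j < n -> path (stage j U) -> path (stage j.+1 0).
Proof.
move=> hj hp; have hv := stage_vector (ltnW hj) (leqnn U).
have hbef v : v < U -> before j.+1 0 v = before j U v.
  by move=> hvU; rewrite /before ltnS hvU andbT andbF orbF leq_eqVlt orbC.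
have e : stage j.+1 0 = (nth (fun=> false, id) (sweep_moves N) 3).2 (stage j U).
  apply: eq_vec => i hi; rewrite ?near_vec //.
    by apply: eq_bigr => v _; rewrite hbef.
  case: (ltnP i.+1 r) => hir.
    rewrite win_vec //; apply: eq_bigr => v _.
    by rewrite hbef // addSnnS.
  have {hir} hir : i.+1 = r by lia.
  rewrite hir win_over ?size_vec // big1 // => v _; rewrite hbef // addSnnS hir.
  apply/eqP; rewrite eqb0; apply/negP => /andP[/andP[hTv hb] hF].
  have hs : start_of v <= j by move: hb; rewrite /before; case/orP=> [/ltnW //|/andP[/eqP -> _]].
  have hFs : F v (start_of v).
    by have /andP[_ /orP[/eqP|]] := starts_atP v; lia.
  case: T_sol => /(_ _ hTv)[h1 h2] _ _.
  by have := window h1 h2 hFs hF; lia.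
apply: (path_move hp hv _ e) => /=.
  rewrite eqxx hj /=; case hf : (far j) => //=; rewrite win_vec //.
  have h := T_sol; case: h => _ _ /(_ j hj (far_neq r_gt0 hf)); apply: leq_ltn_trans.
  rewrite leq_add2l addn0; apply: leq_trans (approvals_sub (before j U) j).
  by apply: leq_sum => v _; rewrite /F hf.
apply: (@horner_lex N [:: k]) => //=.
  by rewrite !size_cat !size_mkseq.
by move: (vec_tail hv) => /= ->; rewrite U_lt.
Qed.

Lemma path_stage j : j <= n -> forall u, u <= U -> path (stage j u).
Proof.
have hu j' : j' <= n -> path (stage j' 0) -> forall u, u <= U -> path (stage j' u).
  move=> hj' h0; elim=> [|u IH] hu //; apply: path_next => //; exact/IH/ltnW.
elim: j => [|j IH] hj; apply: hu => //.
  have -> : stage 0 0 = vec k 0 0 (fun=> 0) (fun=> 0).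
    by apply: eq_vec => i _; apply: big1 => v _; rewrite /before andbF andbF.
  exact: path_start.
by apply: path_shift => //; apply: IH => //; apply: ltnW.
Qed.

Lemma path_accept : path (accept_vec N).
Proof.
have hp := path_stage (leqnn n) (leqnn U); have hv := stage_vector (leqnn n) (leqnn U).
have hbef (v : 'I_U) : before n U v.
  by rewrite /before ltn_ord andbT orbC -leq_eqVlt start_of_le.
have hap z : approvals (fun v => T v && before n U v) z = approvals T z.
  by apply: eq_bigr => v _; rewrite hbef andbT.
apply: (@path_move 4 (stage n U)) => //=.
  rewrite !eqxx /= near_vec; last lia.
  rewrite addnK hap; have hTA : approvals T q = k.
    apply: eq_bigr => v _; case hTv : (T v) => //=.
    by case: T_sol => /(_ _ hTv)[_ ->].
  rewrite hTA eqxx /= sum_nat_eq0; apply/forallP => -[i hi] /=.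
  rewrite eqb0 negbK /check_near near_vec // hap.
  case: (ltnP (q + i) r) => //= h1; case: (leqP n (q + i - r)) => //= h2.
  case: (eqVneq i r) => //= h3.
  by case: T_sol => _ _; apply=> //; apply: contra h3; lia.
apply: (@horner_lex N [::]) => //=.
- exact: leq_ltn_trans k_le R_lt.
- by rewrite size_cat !size_mkseq size_nseq.
- by case/andP: hv => _ /andP[].
Qed.

End Completeness.

End Sweep.

(** * Input numbers as terms *)

Definition flat_lists (ss : seq (seq nat)) : seq nat :=
  flatten (map (fun s => size s :: s) ss).

(** The encoding is the concatenation of the unary codes of this list, so every datum of the
    instance is found by an index into it. *)
Definition nums (I : instance) : seq nat :=
  [:: ncand I, pcand I, size (axis I) & axis I] ++
  size (registered I) :: flat_lists (registered I) ++
  size (unregistered I) :: flat_lists (unregistered I) ++ [:: budget I].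

Definition encode_nums (ns : seq nat) : seq bool := flatten (map enc_nat ns).

Lemma encode_nums_cat s t : encode_nums (s ++ t) = encode_nums s ++ encode_nums t.
Proof. by rewrite /encode_nums map_cat flatten_cat. Qed.

Lemma encode_numsE I : encode I = encode_nums (nums I).
Proof.
have hl ss : flatten (map enc_list ss) = encode_nums (flat_lists ss).
  elim: ss => //= s ss IH; rewrite /flat_lists /= -/(flat_lists ss).
  by rewrite -cat_cons encode_nums_cat IH.
rewrite /nums -[size _ :: _ ++ _]cat1s -[size (unregistered I) :: _]cat1s.
rewrite !encode_nums_cat -!hl /encode /enc_lists /encode_nums.
by rewrite /enc_list /= !cats0 -!catA.
Qed.

Lemma size_encode_nums ns : size (encode_nums ns) = sumn ns + size ns.
Proof.
elim: ns => //= k ns IH; rewrite /encode_nums /= size_cat -/(encode_nums ns) IH.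
by rewrite size_rcons size_nseq; lia.
Qed.

(** The unary code of a number is longer than the number, which makes all data admissible as digits
    and as loop bounds. *)
Lemma nth_lt_size ns i : i < size ns -> nth 0 ns i < size (encode_nums ns).
Proof.
rewrite size_encode_nums; elim: ns i => //= k ns IH [|i] hi.
  by rewrite /= addnS ltnS -addnA leq_addr.
by apply: leq_trans (IH i hi) _; rewrite /= addnS -addnA leqW // leq_addl.
Qed.

(* The ones preceded by exactly i zeros form the unary code of number i. *)
Definition run_length (w : seq bool) i :=
  \sum_(y < size w) if nth false w y then
    nat_of_bool (\sum_(z < y) (~~ nth false w z) == i) else 0.

Lemma run_length_true w i : run_length (true :: w) i = (0 == i) + run_length w i.
Proof.
rewrite /run_length /= big_ord_recl /= big_ord0; congr (_ + _).
by apply: eq_bigr => y _ /=; rewrite big_ord_recl /= add0n.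
Qed.

Lemma run_length_false w i :
  run_length (false :: w) i = if i is i'.+1 then run_length w i' else 0.
Proof.
rewrite /run_length /= big_ord_recl /= add0n; case: i => [|i].
  by rewrite big1 // => y _ /=; rewrite big_ord_recl add1n; case: ifP.
by apply: eq_bigr => y _ /=; rewrite big_ord_recl add1n eqSS.
Qed.

Lemma run_lengthE ns i : run_length (encode_nums ns) i = nth 0 ns i.
Proof.
elim: ns i => [|k ns IH] i; first by rewrite /run_length big_ord0 nth_nil.
rewrite /encode_nums /= -/(encode_nums ns) /enc_nat.
have h j : run_length (rcons (nseq j true) false ++ encode_nums ns) i =
    if i is i'.+1 then nth 0 ns i' else j.
  elim: j => [|j IHj] /=; first by rewrite run_length_false; case: i.
  by rewrite run_length_true IHj; case: (i).
by rewrite h; case: (i).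
Qed.

(** The input is stored last symbol first. The reversed index [N - v - 1] is obtained without
    subtraction, as the number of [i < N] above [v]. *)
Definition WBIT (t t1 t2 : term) : term := BIT (SUM (fun i => LT t i)) t1 t2.

Definition NUM (t : term) : term :=
  SUM (fun y => WBIT y (EQ (SUMLT y (fun z => WBIT z ZERO ONE)) t) ZERO).

Section Input.
Variable ns : seq nat.
Let w := encode_nums ns.
Let N := size w.
Let inb := nth false (rev w).
Local Notation tspec := (tspec N inb).

Lemma tspec_wbit G t t1 t2 v v1 v2 : v < N -> tspec G t v -> tspec G t1 v1 ->
  tspec G t2 v2 -> tspec G (WBIT t t1 t2) (if nth false w v then v1 else v2).
Proof.
move=> hv ht h1 h2.
have -> : nth false w v = inb (\sum_(i < N) (v < i)).
  have -> : \sum_(i < N) (v < i) = N - v.+1.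
    elim: (N) => [|m IH]; first by rewrite big_ord0.
    by rewrite big_ord_recr /= IH; case: ltnP; lia.
  by rewrite /inb nth_rev -/N; [congr nth|]; lia.
apply: tspec_bit => //; apply: (@tspec_sum _ _ G _ (fun i => nat_of_bool (v < i))).
move=> x i hi; apply: tspec_lt; first exact: tspec_weak.
by apply: tspec_var; rewrite mem_head.
Qed.

Lemma tspec_num G t v : tspec G t v -> tspec G (NUM t) (nth 0 ns v).
Proof.
move=> ht; rewrite -run_lengthE -/w.
apply: (@tspec_sum _ _ G _ (fun y => if nth false w y then
    nat_of_bool (\sum_(z < y) (~~ nth false w z) == v) else 0)) => x y hy.
have hx : tspec ((x, y) :: G) (VAR x) y by apply: tspec_var; rewrite mem_head.
apply: tspec_wbit => //; last exact: tspec_zero.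
apply: tspec_eq; last exact: tspec_weak.
apply: (@tspec_sumlt _ _ _ _ _ _ (fun z => nat_of_bool (~~ nth false w z))) => //.
  exact: ltnW.
move=> x' z hz; apply: (tspec_eqv (v := if nth false w z then 0 else 1)).
  apply: tspec_wbit; [exact: ltn_trans hy | | exact: tspec_zero | exact: tspec_one].
  by apply: tspec_var; rewrite mem_head.
by case: nth.
Qed.

End Input.

(** * Layout of the input numbers, and the sweep written as terms *)

Lemma size_flat_lists n ss : all (fun v => size v == n) ss ->
  size (flat_lists ss) = size ss * n.+1.
Proof.
rewrite /flat_lists; elim: ss => //= v ss IH /andP[/eqP hv hss].
by rewrite size_cat IH // hv mulSn addSn.
Qed.

(** Each vote is preceded by its length and so takes [n.+1] entries, the first of which is
    skipped. *)
Lemma nth_flat_lists n ss t u i : all (fun v => size v == n) ss -> u < size ss ->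
  i < n -> nth 0 (flat_lists ss ++ t) (u * n.+1 + i.+1) = nth 0 (nth [::] ss u) i.
Proof.
rewrite /flat_lists; elim: ss u => //= v ss IH [|u] /andP[/eqP hv hss] hu hi.
  by rewrite /= -catA nth_cat hv hi.
rewrite -catA mulSn -addnA addSn /= nth_cat hv ltnNge leq_addr /= addKn.
exact: IH.
Qed.

(** Addresses in [nums I]: the axis occupies 3 to [n + 2], after its length at 2; the number of
    registered votes is at [n + 3], followed by the votes; [UNREG_AT] starts the same layout for
    unregistered votes, and the budget comes last. *)
Definition NPOS : term := NUM (CONST 0).
Definition NPREF : term := NUM (CONST 1).
Definition NAXIS (z : term) : term := NUM (ADD (CONST 3) z).
Definition NREG : term := NUM (ADD (CONST 3) NPOS).
Definition NREGVOTE (u i : term) : term :=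
  NUM (ADD (ADD (CONST 4) NPOS) (ADD (MUL u (ADD ONE NPOS)) (ADD ONE i))).
Definition UNREG_AT : term := ADD (CONST 4) (ADD NPOS (MUL NREG (ADD ONE NPOS))).
Definition NUNREG : term := NUM UNREG_AT.
Definition NUNREGVOTE (u i : term) : term :=
  NUM (ADD (ADD ONE UNREG_AT) (ADD (MUL u (ADD ONE NPOS)) (ADD ONE i))).
Definition NBUDGET : term :=
  NUM (ADD (ADD ONE UNREG_AT) (MUL NUNREG (ADD ONE NPOS))).

Section MoveTerms.
Variable r : nat.

Definition APPROVES (vote : term -> term) (c : term) : term :=
  LT ZERO (SUMLT NPOS (fun i => AND (LT i (CONST r)) (EQ (vote i) c))).
Definition APPR (u z : term) : term :=
  AND (LT z NPOS) (APPROVES (NUNREGVOTE u) (NAXIS z)).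
Definition REGSCORE (z : term) : term :=
  SUMLT NREG (fun u => APPROVES (NREGVOTE u) (NAXIS z)).
(** A search written as a sum: p occurs once on the axis, so only its position contributes. *)
Definition PPOS : term := SUMLT NPOS (fun z => IF (EQ (NAXIS z) NPREF) z ZERO).
Definition FAR (z : term) : term :=
  NOT (AND (LT PPOS (ADD (ADD z (CONST r)) ONE)) (LT z (ADD PPOS (CONST r)))).
Definition FARAPPR (u z : term) : term := AND (FAR z) (APPR u z).
Definition STARTS (u j : term) : term :=
  AND (EQ (SUMLT j (FARAPPR u)) ZERO) (OR (EQ j NPOS) (FARAPPR u j)).
(* Truncated at the input length, which exceeds every axis position. *)
Definition NEARPOS (i : nat) : term :=
  SUM (fun y => LT (ADD y (CONST r)) (ADD PPOS (CONST i))).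

Definition DIG (i : nat) : term := VAR (i + 2).
Definition NEARD (i : nat) : term := DIG (3 + i).
Definition WIND (i : nat) : term := DIG (3 + (2 * r + i)).

Definition BELOW (z d : term) : term :=
  LT (ADD (REGSCORE z) d) (ADD (REGSCORE PPOS) (DIG 0)).
Definition CHECK (i : nat) : term :=
  OR (LT (ADD PPOS (CONST i)) (CONST r))
    (OR (NOT (LT (NEARPOS i) NPOS))
      (OR (EQ (CONST i) (CONST r)) (BELOW (NEARPOS i) (NEARD i)))).

(** Unrolled when the program is built, since its summands read different registers and a register
    number cannot be computed at run time. *)
Fixpoint SUMC (m : nat) (F : nat -> term) : term :=
  if m is m'.+1 then ADD (SUMC m' F) (F m') else ZERO.

Definition TVEC (k j u : term) (f g : nat -> term) : seq term :=
  [:: k, j, u & mkseq f (2 * r) ++ mkseq g r].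

Definition sweep_terms : seq move_term :=
  [:: (AND (EQ (DIG 1) ZERO) (AND (EQ (DIG 2) ZERO) (LT (DIG 0) NBUDGET)),
       TVEC (ADD ONE (DIG 0)) (DIG 1) (DIG 2) NEARD WIND);
      (LT (DIG 2) NUNREG, TVEC (DIG 0) (DIG 1) (ADD ONE (DIG 2)) NEARD WIND);
      (AND (LT (DIG 2) NUNREG) (AND (APPR (DIG 2) PPOS) (STARTS (DIG 2) (DIG 1))),
       TVEC (DIG 0) (DIG 1) (ADD ONE (DIG 2))
         (fun i => ADD (NEARD i) (APPR (DIG 2) (NEARPOS i)))
         (fun i => ADD (WIND i) (FARAPPR (DIG 2) (ADD (DIG 1) (CONST i)))));
      (AND (EQ (DIG 2) NUNREG) (AND (LT (DIG 1) NPOS)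
         (OR (NOT (FAR (DIG 1))) (BELOW (DIG 1) (WIND 0)))),
       TVEC (DIG 0) (ADD ONE (DIG 1)) ZERO NEARD
         (fun i => if i.+1 < r then WIND i.+1 else ZERO));
      (AND (EQ (DIG 2) NUNREG) (AND (EQ (DIG 1) NPOS) (AND (EQ (NEARD r) (DIG 0))
         (EQ (SUMC (2 * r) (fun i => NOT (CHECK i))) ZERO))),
       TOP :: nseq (dim r).-1 ZERO)].

Variable I : instance.
Let n := ncand I.
Let U := size (unregistered I).
Let R := budget I.
Let reg_votes := registered I.
Let unreg_votes := unregistered I.
Hypothesis size_axis : size (axis I) = n.
Hypothesis size_votes : all (fun v => size v == n) (reg_votes ++ unreg_votes).

Definition approves (v : seq nat) (c : nat) : bool :=
  0 < \sum_(i < n) ((i < r) && (nth 0 v i == c)).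
Definition axis_at z := nth 0 (axis I) z.
Definition unreg_appr u z :=
  (z < n) && approves (nth [::] unreg_votes u) (axis_at z).
Definition reg_score z :=
  \sum_(u < size reg_votes) approves (nth [::] reg_votes u) (axis_at z).
Definition p_pos := index (pcand I) (axis I).

Let ns := nums I.
Let N := size (encode_nums ns).
Let inb := nth false (rev (encode_nums ns)).
Local Notation tspec := (tspec N inb).

Let size_reg : all (fun v => size v == n) reg_votes.
Proof. by move: size_votes; rewrite all_cat => /andP[]. Qed.
Let size_unreg : all (fun v => size v == n) unreg_votes.
Proof. by move: size_votes; rewrite all_cat => /andP[]. Qed.

Lemma nth_axis z : z < n -> nth 0 ns (3 + z) = axis_at z.
Proof. by move=> hz; rewrite /ns /nums /= add0n nth_cat size_axis hz. Qed.

Lemma nums_reg i : nth 0 ns (3 + (n + i)) =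
  nth 0 (size reg_votes :: flat_lists reg_votes ++
    size unreg_votes :: flat_lists unreg_votes ++ [:: R]) i.
Proof.
rewrite /ns /nums; set s := _ :: flat_lists _ ++ _.
by rewrite [LHS]/= add0n nth_cat size_axis ltnNge leq_addr /= addKn.
Qed.

Let unreg_at := 4 + (n + size reg_votes * n.+1).

Lemma nums_unreg i : nth 0 ns (unreg_at + i) =
  nth 0 (size unreg_votes :: flat_lists unreg_votes ++ [:: R]) i.
Proof.
rewrite /unreg_at (_ : _ + i = 3 + (n + (size reg_votes * n.+1 + i).+1)); last lia.
rewrite nums_reg [LHS]/= nth_cat (size_flat_lists size_reg).
by rewrite ltnNge leq_addr /= addKn.
Qed.

Lemma tspec_npos G : tspec G NPOS n.
Proof. by rewrite -[n]/(nth 0 ns 0); apply/tspec_num/tspec_const. Qed.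

Lemma tspec_npref G : tspec G NPREF (pcand I).
Proof. by rewrite -[pcand I]/(nth 0 ns 1); apply/tspec_num/tspec_const. Qed.

Lemma tspec_naxis G t z : z < n -> tspec G t z -> tspec G (NAXIS t) (axis_at z).
Proof.
move=> hz ht; rewrite -nth_axis //; apply: tspec_num.
exact: tspec_add (@tspec_const _ _ _ _) ht.
Qed.

Lemma tspec_nreg G : tspec G NREG (size reg_votes).
Proof.
have -> : size reg_votes = nth 0 ns (3 + n) by rewrite -[n]addn0 nums_reg.
exact: tspec_num (tspec_add (@tspec_const _ _ _ _) (@tspec_npos _)).
Qed.

Let bounded i : i < size ns -> nth 0 ns i < N.
Proof. exact: nth_lt_size. Qed.

Lemma size_nums : size ns = unreg_at + (U * n.+1).+2.
Proof.
rewrite /ns /nums !(size_cat, size_axis) /= !size_cat /= size_cat.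
rewrite (size_flat_lists size_reg) (size_flat_lists size_unreg) size_axis /=.
by rewrite /unreg_at /reg_votes /U /unreg_votes; lia.
Qed.

Lemma n_lt_N : n < N.
Proof. by apply: (@bounded 0); rewrite size_nums. Qed.

Lemma U_lt_N : U < N.
Proof.
have -> : U = nth 0 ns unreg_at by rewrite -[unreg_at]addn0 nums_unreg.
by apply: bounded; rewrite size_nums; lia.
Qed.

Lemma budget_at : nth 0 ns (unreg_at.+1 + U * n.+1) = R.
Proof.
rewrite addSnnS nums_unreg /= nth_cat (size_flat_lists size_unreg).
by rewrite ltnn subnn.
Qed.

Lemma R_lt_N : R < N.
Proof. by rewrite -budget_at; apply: bounded; rewrite size_nums; lia. Qed.

Lemma reg_le_N : size reg_votes <= N.
Proof.
have -> : size reg_votes = nth 0 ns (3 + n) by rewrite -[n]addn0 nums_reg.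
by apply/ltnW/bounded; rewrite size_nums /unreg_at; lia.
Qed.

Lemma tspec_succ G t v : tspec G t v -> tspec G (ADD ONE t) v.+1.
Proof. by move=> h; rewrite -add1n; apply: tspec_add => //; apply: tspec_one. Qed.

Lemma tspec_nregvote G tu ti u i : u < size reg_votes -> i < n ->
  tspec G tu u -> tspec G ti i ->
  tspec G (NREGVOTE tu ti) (nth 0 (nth [::] reg_votes u) i).
Proof.
move=> hu hi h1 h2; rewrite -(nth_flat_lists (size unreg_votes :: flat_lists unreg_votes ++ [:: R]) size_reg hu hi).
rewrite -[nth 0 _ _]/(nth 0 (size reg_votes :: _) (u * n.+1 + i.+1).+1).
rewrite -nums_reg; apply: tspec_num.
apply: (tspec_eqv (v := (4 + n) + (u * n.+1 + i.+1))); last by lia.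
apply: tspec_add; first exact: tspec_add (@tspec_const _ _ _ _) (@tspec_npos _).
apply: tspec_add; last exact: tspec_succ.
apply: tspec_mul h1 _ (tspec_succ (@tspec_npos _)).
exact: leq_trans (ltnW hu) reg_le_N.
Qed.

Lemma tspec_unreg_at G : tspec G UNREG_AT unreg_at.
Proof.
apply: tspec_add (@tspec_const _ _ _ _) (tspec_add (@tspec_npos _) _).
exact: tspec_mul (@tspec_nreg _) reg_le_N (tspec_succ (@tspec_npos _)).
Qed.

Lemma tspec_nunreg G : tspec G NUNREG U.
Proof.
have -> : U = nth 0 ns unreg_at by rewrite -[unreg_at]addn0 nums_unreg.
exact: tspec_num (@tspec_unreg_at _).
Qed.

Lemma tspec_nunregvote G tu ti u i : u < U -> i < n ->
  tspec G tu u -> tspec G ti i ->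
  tspec G (NUNREGVOTE tu ti) (nth 0 (nth [::] unreg_votes u) i).
Proof.
move=> hu hi h1 h2; rewrite -(nth_flat_lists [:: R] size_unreg hu hi).
rewrite -[nth 0 _ _]/(nth 0 (size unreg_votes :: _) (u * n.+1 + i.+1).+1).
rewrite -nums_unreg; apply: tspec_num.
apply: (tspec_eqv (v := unreg_at.+1 + (u * n.+1 + i.+1))); last by lia.
apply: tspec_add; first exact: tspec_succ (@tspec_unreg_at _).
apply: tspec_add; last exact: tspec_succ.
apply: tspec_mul h1 _ (tspec_succ (@tspec_npos _)).
exact: ltnW (ltn_trans hu U_lt_N).
Qed.

Lemma tspec_nbudget G : tspec G NBUDGET R.
Proof.
rewrite -budget_at; apply/tspec_num/tspec_add; first exact: tspec_succ (@tspec_unreg_at _).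
exact: tspec_mul (@tspec_nunreg _) (ltnW U_lt_N) (tspec_succ (@tspec_npos _)).
Qed.

Lemma tspec_approves G vote tc v c :
  (forall x i, i < n -> tspec ((x, i) :: G) (vote (VAR x)) (nth 0 v i)) ->
  tspec G tc c -> tspec G (APPROVES vote tc) (approves v c).
Proof.
move=> hv hc; apply: tspec_lt (@tspec_zero _ _ _) _.
apply: (@tspec_sumlt _ _ _ _ _ _ (fun i => nat_of_bool ((i < r) && (nth 0 v i == c)))).
- exact: tspec_npos.
- exact: ltnW n_lt_N.
move=> x i hi; apply: tspec_and => [|_].
  by apply: tspec_lt (@tspec_const _ _ _ _); apply: tspec_var; rewrite mem_head.
by apply: tspec_eq; [exact: hv | exact: tspec_weak].
Qed.

Lemma tspec_appr G tu tz u z : u < U -> tspec G tu u -> tspec G tz z ->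
  tspec G (APPR tu tz) (unreg_appr u z).
Proof.
move=> hu h1 h2; apply: tspec_and => [|hz]; first exact: tspec_lt h2 (@tspec_npos _).
apply: tspec_approves; last exact: tspec_naxis.
move=> x i hi; apply: tspec_nunregvote => //; first exact: tspec_weak.
by apply: tspec_var; rewrite mem_head.
Qed.

Lemma tspec_regscore G tz z : z < n -> tspec G tz z ->
  tspec G (REGSCORE tz) (reg_score z).
Proof.
move=> hz h; apply: (@tspec_sumlt _ _ _ _ _ _
  (fun u => nat_of_bool (approves (nth [::] reg_votes u) (axis_at z)))).
- exact: tspec_nreg.
- exact: reg_le_N.
move=> x u hu; apply: tspec_approves; last by apply: tspec_naxis => //; exact: tspec_weak.
move=> y i hi; apply: tspec_nregvote => //.
  by apply: tspec_weak; apply: tspec_var; rewrite mem_head.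
by apply: tspec_var; rewrite mem_head.
Qed.

Hypothesis p_axis : pcand I \in axis I.
Hypothesis axis_uniq : uniq (axis I).

Lemma p_pos_lt : p_pos < n.
Proof. by rewrite /p_pos -size_axis index_mem. Qed.

Lemma tspec_ppos G : tspec G PPOS p_pos.
Proof.
apply: (tspec_eqv (v := \sum_(z < n) if axis_at z == pcand I then nat_of_ord z else 0)).
  apply: (@tspec_sumlt _ _ _ _ _ _ (fun z => if axis_at z == pcand I then z else 0)).
  - exact: tspec_npos.
  - exact: ltnW n_lt_N.
  move=> x z hz; have hx : tspec ((x, z) :: G) (VAR x) z.
    by apply: tspec_var; rewrite mem_head.
  apply: tspec_if => [|//|_]; last exact: tspec_zero.
  by apply: tspec_eq (@tspec_npref _); apply: tspec_naxis.
rewrite (bigD1 (Ordinal p_pos_lt)) //= big1 => [|z hz].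
  by rewrite /axis_at nth_index // eqxx addn0.
case: eqP => // e; exfalso; move/eqP: hz; apply; apply: val_inj => /=.
by rewrite /p_pos -e index_uniq // size_axis.
Qed.

Local Notation far := (far p_pos r).
Local Notation far_appr := (far_appr p_pos r unreg_appr).

Lemma tspec_far G tz z : tspec G tz z -> tspec G (FAR tz) (far z).
Proof.
move=> h; apply: tspec_not; apply: tspec_and => [|_].
  rewrite -ltnS -[(z + r).+1]addn1; apply: tspec_lt (@tspec_ppos _) _.
  exact: tspec_add (tspec_add h (@tspec_const _ _ _ _)) (@tspec_one _ _ _).
exact: tspec_lt h (tspec_add (@tspec_ppos _) (@tspec_const _ _ _ _)).
Qed.

Lemma tspec_farappr G tu tz u z : u < U -> tspec G tu u -> tspec G tz z ->
  tspec G (FARAPPR tu tz) (far_appr u z).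
Proof.
by move=> hu h1 h2; apply: tspec_and => [|_]; [apply: tspec_far | apply: tspec_appr].
Qed.

Lemma tspec_starts G tu tj u j : u < U -> j <= N -> tspec G tu u -> tspec G tj j ->
  tspec G (STARTS tu tj) (starts_at n p_pos r unreg_appr u j).
Proof.
move=> hu hj h1 h2; apply: tspec_and => [|_].
  apply: tspec_eq (@tspec_zero _ _ _).
  apply: (@tspec_sumlt _ _ _ _ _ _ (fun z => nat_of_bool (far_appr u z))) => //.
  move=> x z hz; apply: tspec_farappr => //; first exact: tspec_weak.
  by apply: tspec_var; rewrite mem_head.
apply: tspec_or => [|_]; last exact: tspec_farappr.
exact: tspec_eq h2 (@tspec_npos _).
Qed.

Lemma tspec_nearpos G i : tspec G (NEARPOS i) (minn N (p_pos + i - r)).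
Proof.
apply: (tspec_eqv (v := \sum_(y < N) (y + r < p_pos + i))).
  apply: (@tspec_sum _ _ _ _ (fun y => nat_of_bool (y + r < p_pos + i))) => x y hy.
  apply: tspec_lt; last exact: tspec_add (@tspec_ppos _) (@tspec_const _ _ _ _).
  by apply: tspec_add (@tspec_const _ _ _ _); apply: tspec_var; rewrite mem_head.
elim: (N) => [|m IH]; first by rewrite big_ord0 min0n.
by rewrite big_ord_recr /= IH; case: ltnP; lia.
Qed.

(** Positions beyond the axis receive no approvals, and [N] is one of them, so the truncation in
    [NEARPOS] is harmless. *)
Lemma unreg_appr_cap u z : unreg_appr u (minn N z) = unreg_appr u z.
Proof.
case: (leqP N z) => // h; rewrite /unreg_appr.
by rewrite !ltnNge (ltnW n_lt_N) (leq_trans (ltnW n_lt_N) h).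
Qed.

Hypothesis r_gt0 : 0 < r.

Section AtVector.
Variable x : seq nat.
Hypothesis hx : is_vector (dim r) N x.
Let G := digit_ctx x.

Lemma tspec_dig i : i < dim r -> tspec G (DIG i) (nth 0 x i).
Proof.
move=> hi; have /andP[/eqP hs _] := hx; apply: tspec_var.
rewrite /G /digit_ctx; apply/(nthP (0, 0)); exists i.
  by rewrite size_zip size_iota minnn hs.
rewrite nth_zip ?size_iota // nth_iota ?hs //.
by rewrite addnC.
Qed.

Lemma dig_lt i : i < dim r -> nth 0 x i < N.
Proof.
move=> hi; have /andP[/eqP hs /(all_nthP 0) h] := hx.
by apply: h; rewrite hs.
Qed.

Lemma tspec_near i : i < 2 * r -> tspec G (NEARD i) (near_digit x i).
Proof. by move=> hi; apply: tspec_dig; rewrite /dim; lia. Qed.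

Lemma tspec_win i : i < r -> tspec G (WIND i) (win_digit r x i).
Proof. by move=> hi; apply: tspec_dig; rewrite /dim; lia. Qed.

Lemma tspecs_cat ts1 vs1 ts2 vs2 : tspecs N inb G ts1 vs1 ->
  tspecs N inb G ts2 vs2 -> tspecs N inb G (ts1 ++ ts2) (vs1 ++ vs2).
Proof. by elim: ts1 vs1 => [|t ts IH] [|v vs] //= [h1 h2] h3; split; auto. Qed.

Lemma tspecs_mkseq m (f : nat -> term) g : (forall i, i < m -> tspec G (f i) (g i)) ->
  tspecs N inb G (mkseq f m) (mkseq g m).
Proof.
move=> h; have {h} : forall i, i \in iota 0 m -> tspec G (f i) (g i).
  by move=> i; rewrite mem_iota => /andP[_]; apply: h.
rewrite /mkseq; elim: (iota 0 m) => //= i s IH h; split.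
  by apply: h; rewrite mem_head.
by apply: IH => j hj; apply: h; rewrite inE hj orbT.
Qed.

Lemma tspecs_vec tk tj tu k j u f g f' g' : tspec G tk k -> tspec G tj j ->
  tspec G tu u -> (forall i, i < 2 * r -> tspec G (f i) (f' i)) ->
  (forall i, i < r -> tspec G (g i) (g' i)) ->
  tspecs N inb G (TVEC tk tj tu f g) (vec r k j u f' g').
Proof.
move=> h1 h2 h3 h4 h5; rewrite /TVEC /vec /=; split=> //; split=> //; split=> //.
by apply: tspecs_cat; apply: tspecs_mkseq.
Qed.

Lemma tspec_below tz td z d : z < n -> tspec G tz z -> tspec G td d ->
  tspec G (BELOW tz td) (reg_score z + d < reg_score p_pos + nth 0 x 0).
Proof.
move=> hz h1 h2; apply: tspec_lt; apply: tspec_add => //.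
- exact: tspec_regscore.
- exact: tspec_regscore p_pos_lt (@tspec_ppos _).
- exact: tspec_dig.
Qed.

Lemma tspec_check i : i < 2 * r ->
  tspec G (CHECK i) (check_near n p_pos r reg_score x i).
Proof.
move=> hi; apply: tspec_or => [|h].
  exact: tspec_lt (tspec_add (@tspec_ppos _) (@tspec_const _ _ _ _)) (@tspec_const _ _ _ _).
have hp := @tspec_nearpos G i; have hnN := n_lt_N.
apply: tspec_or => [|hlt].
  have -> : (n <= p_pos + i - r) = ~~ (minn N (p_pos + i - r) < n) by lia.
  exact: tspec_not (tspec_lt hp (@tspec_npos _)).
rewrite (minn_idPr _) in hp; last lia.
apply: tspec_or => [|_]; first exact: tspec_eq (@tspec_const _ _ _ _) (@tspec_const _ _ _ _).
apply: tspec_below => //; last exact: tspec_near.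
by rewrite ltnNge.
Qed.

Lemma tspec_sumc m (F : nat -> term) f : (forall i, i < m -> tspec G (F i) (f i)) ->
  tspec G (SUMC m F) (\sum_(i < m) f i).
Proof.
elim: m => [|m IH] h; first by rewrite big_ord0; apply: tspec_zero.
rewrite big_ord_recr /=; apply: tspec_add; last exact: h.
by apply: IH => i hi; apply: h; apply: ltnW.
Qed.

End AtVector.

Lemma sweep_terms_spec :
  moves_spec (dim r) N inb sweep_terms
    (sweep_moves n p_pos r U R unreg_appr reg_score N).
Proof.
have d0 : 0 < dim r by [].
have d1 : 1 < dim r by [].
have d2 : 2 < dim r by [].
split; [|split; [|split; [|split; [|split=> //]]]] => x hx;
  have h0 := tspec_dig hx d0; have h1 := tspec_dig hx d1;
  have h2 := tspec_dig hx d2; have l1 := dig_lt hx d1;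
  have hnear i := @tspec_near x hx i; have hwin i := @tspec_win x hx i; split=> [|hg].
- apply: tspec_and => [|_]; first exact: tspec_eq h1 (@tspec_zero _ _ _).
  apply: tspec_and => [|_]; first exact: tspec_eq h2 (@tspec_zero _ _ _).
  exact: tspec_lt h0 (@tspec_nbudget _).
- by apply: tspecs_vec => //; apply: tspec_succ.
- exact: tspec_lt h2 (@tspec_nunreg _).
- by apply: tspecs_vec => //; apply: tspec_succ.
- apply: tspec_and => [|hu]; first exact: tspec_lt h2 (@tspec_nunreg _).
  apply: tspec_and => [|_]; first exact: tspec_appr hu h2 (@tspec_ppos _).
  exact: tspec_starts hu (ltnW l1) h2 h1.
- have hu : nth 0 x 2 < U by case/and3P: hg.
  apply: tspecs_vec => //; first exact: tspec_succ.
    move=> i hi; apply: tspec_add (hnear i hi) _; rewrite -unreg_appr_cap.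
    exact: tspec_appr hu h2 (@tspec_nearpos _ _).
  move=> i hi; apply: tspec_add (hwin i hi) _.
  exact: tspec_farappr hu h2 (tspec_add h1 (@tspec_const _ _ _ _)).
- apply: tspec_and => [|_]; first exact: tspec_eq h2 (@tspec_nunreg _).
  apply: tspec_and => [|hj]; first exact: tspec_lt h1 (@tspec_npos _).
  apply: tspec_or => [|_]; first exact: tspec_not (tspec_far h1).
  by apply: tspec_below => //; apply: hwin.
- apply: tspecs_vec => //; first exact: tspec_succ.
    exact: tspec_zero.
  move=> i hi; case: ltnP => h; first exact: hwin.
  (* Here [win_digit] reads past the end of the vector and returns the default 0. *)
  have -> : i.+1 = r by lia.
  by rewrite win_over; [apply: tspec_zero | case/andP: hx => /eqP].
- apply: tspec_and => [|_]; first exact: tspec_eq h2 (@tspec_nunreg _).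
  apply: tspec_and => [|_]; first exact: tspec_eq h1 (@tspec_npos _).
  apply: tspec_and => [|_]; first by apply: tspec_eq h0; apply: hnear; lia.
  apply: tspec_eq (@tspec_zero _ _ _).
  apply: (@tspec_sumc x _ _ (fun i => nat_of_bool (~~ check_near n p_pos r reg_score x i))).
  by move=> i hi; apply: tspec_not; apply: tspec_check.
- split; first exact: tspec_top.
  elim: (dim r).-1 => //= m IH; split=> //; exact: tspec_zero.
Qed.

End MoveTerms.

(** * Two-peaked elections *)

Lemma index_filter_lt (T : eqType) (P : pred T) (s : seq T) a b : P a -> P b ->
  (index a (filter P s) < index b (filter P s)) = (index a s < index b s).
Proof.
move=> ha hb; elim: s => //= x s IH; case hx : (P x) => /=.
  by case: (x == a); case: (x == b); rewrite ?ltnS ?IH.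
have -> : (x == a) = false by apply/eqP => e; rewrite e ha in hx.
have -> : (x == b) = false by apply/eqP => e; rewrite e hb in hx.
by rewrite ltnS.
Qed.

Section TwoPeaked.
Variables (r n : nat) (L v : seq nat).
Hypotheses (hL : perm_eq L (iota 0 n)) (hv : perm_eq v (iota 0 n)).

Definition top z := index (nth 0 L z) v < r.

Let L_uniq : uniq L. Proof. by rewrite (perm_uniq hL) iota_uniq. Qed.
Let L_size : size L = n. Proof. by rewrite (perm_size hL) size_iota. Qed.
Let L_mem z : z < n -> nth 0 L z \in v.
Proof. by move=> hz; rewrite (perm_mem hv) -(perm_mem hL) mem_nth // L_size. Qed.

(** If the candidate at [y] were not among the top [r], the one at [z] would be preferred to it,
    hence it to the one at [x], which is among the top [r]. *)
Lemma single_peaked_convex B (f : nat -> nat) x y z : single_peaked (restrict v B) B ->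
  uniq B -> x < y < z -> z < size B ->
  index (nth 0 B x) v < r -> index (nth 0 B z) v < r -> index (nth 0 B y) v < r.
Proof.
move=> hsp hB /andP[hxy hyz] hz htx htz; rewrite ltnNge; apply/negP => hty.
have hy := ltn_trans hyz hz; have hx := ltn_trans hxy hy.
have hp : prefers (restrict v B) (nth 0 B y) (nth 0 B x).
  apply: (hsp _ _ (nth 0 B z)); rewrite ?mem_nth //.
    by rewrite /between !index_uniq // hxy hyz.
  by rewrite /prefers index_filter_lt ?mem_nth // (leq_trans htz).
move: hp; rewrite /prefers index_filter_lt ?mem_nth // ltnNge.
by rewrite (leq_trans (ltnW htx)).
Qed.

(** [m] is the boundary between the blocks; a splitting into fewer than two blocks is padded with
    empty ones. *)
Lemma two_peaked_convex : k_peaked 2 L v -> exists m, forall x y z,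
  x < y < z -> z < n -> (z < m) || (m <= x) -> top x -> top z -> top y.
Proof.
move=> [Ls [hflat _ hsize hsp]].
have [B1 [B2 [eL h1 h2]]] : exists B1 B2, [/\ L = B1 ++ B2,
    single_peaked (restrict v B1) B1 & single_peaked (restrict v B2) B2].
  have h0 : single_peaked (restrict v [::]) [::] by [].
  case: Ls hflat hsize hsp => [|B1 [|B2 [|]]] //= <- _ hsp.
  - by exists [::], [::].
  - exists B1, [::]; rewrite cats0; split=> //.
    by apply: hsp; rewrite mem_head.
  - exists B1, B2; rewrite cats0; split=> //; apply: hsp.
      by rewrite mem_head.
    by rewrite !inE eqxx orbT.
have := L_uniq; rewrite eL cat_uniq => /and3P[u1 _ u2].
exists (size B1) => x y z hxyz hz; have /andP[hxy hyz] := hxyz.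
rewrite /top eL !nth_cat => /orP[hz1|hx1].
  rewrite hz1 (ltn_trans hyz hz1) (ltn_trans hxy (ltn_trans hyz hz1)).
  exact: single_peaked_convex.
have hy1 : size B1 <= y by lia.
have hz1 : size B1 <= z by lia.
rewrite !ltnNge hx1 hy1 hz1 /= -!ltnNge.
apply: single_peaked_convex => //; first by lia.
by rewrite -L_size eL size_cat in hz; lia.
Qed.

(** The ranks in [v] of the candidates of the interval are distinct and below [r]. *)
Lemma top_span x z : x <= z -> z < n -> (forall y, x <= y <= z -> top y) -> z < x + r.
Proof.
move=> hxz hz htop; pose s := map (fun y => index (nth 0 L y) v) (iota x (z - x).+1).
have hin y : y \in iota x (z - x).+1 -> x <= y <= z by rewrite mem_iota; lia.
have hs : uniq s.
  rewrite map_inj_in_uniq ?iota_uniq // => y y' /hin hy /hin hy' e.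
  have hyn : y < n by lia. have hyn' : y' < n by lia.
  have e' : nth 0 L y = nth 0 L y'.
    by rewrite -[LHS](nth_index 0 (L_mem hyn)) e nth_index // L_mem.
  by apply/eqP; rewrite -(nth_uniq 0 _ _ L_uniq) ?L_size // e'.
have hsub : {subset s <= iota 0 r}.
  by move=> i /mapP[y /hin hy ->]; rewrite mem_iota add0n; apply: htop.
have := uniq_leq_size hs hsub; rewrite size_map !size_iota; lia.
Qed.

(** A far approved position in the block of [q] would be joined to [q] by an approved interval, too
    long for [top_span]. So all far approved positions share the other block, where [top_span]
    applies to any two of them. *)
Lemma two_peaked_window q x y : 0 < r -> q < n -> x < n -> y < n ->
  k_peaked 2 L v -> top q -> far q r x -> top x -> far q r y -> top y -> y < x + r.
Proof.
move=> r0 hq hx hy /two_peaked_convex[m hm] tq fx tx fy ty.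
have span a b : a < b -> b < n -> (b < m) || (m <= a) -> top a -> top b -> b < a + r.
  move=> hab hb hside ha htb; apply: top_span => //; first exact: ltnW.
  move=> c /andP[hac hcb]; case: (eqVneq a c) => [<- //|nac].
  case: (eqVneq c b) => [-> //|ncb].
  by apply: hm hside ha htb => //; lia.
have side z : z < n -> far q r z -> top z -> (z < m) != (q < m).
  move=> hz fz tz; apply/negP => /eqP e; move: fz; rewrite /far.
  case: (ltngtP z q) => [h|h|->].
  - have hs : (q < m) || (m <= z) by rewrite (leqNgt m z) e orbN.
    have := span _ _ h hq hs tz tq; lia.
  - have hs : (z < m) || (m <= q) by rewrite (leqNgt m q) e orbN.
    have := span _ _ h hz hs tq tz; lia.
  - lia.
case: (ltnP x y) => h; last by lia.
apply: span => //; have := side x hx fx tx; have := side y hy fy ty.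
by rewrite [m <= x]leqNgt; case: (x < m); case: (y < m); case: (q < m).
Qed.

End TwoPeaked.

(** * From valid instances to solutions of the sweep *)

Section Correctness.
Variables (r : nat) (I : instance).
Hypothesis r_gt0 : 0 < r.
Hypothesis I_valid : valid_instance 2 I.

Let n := ncand I.
Let U := size (unregistered I).
Let q := p_pos I.
Let A := unreg_appr r I.
Let S := reg_score r I.

Let p_lt : pcand I < n. Proof. by case: I_valid. Qed.
Let axis_perm : perm_eq (axis I) (iota 0 n). Proof. by case: I_valid. Qed.
Let vote_perm v : v \in registered I ++ unregistered I -> perm_eq v (iota 0 n).
Proof. by move=> h; case: I_valid => _ _ /allP /(_ _ h). Qed.

Lemma valid_axis_size : size (axis I) = n.
Proof. by rewrite (perm_size axis_perm) size_iota. Qed.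

Lemma valid_axis_uniq : uniq (axis I).
Proof. by rewrite (perm_uniq axis_perm) iota_uniq. Qed.

Lemma valid_axis_mem c : (c \in axis I) = (c < n).
Proof. by rewrite (perm_mem axis_perm) mem_iota. Qed.

Lemma valid_votes_size : all (fun v => size v == n) (registered I ++ unregistered I).
Proof.
by apply/allP => v /vote_perm h; rewrite (perm_size h) size_iota.
Qed.

Lemma approvesE v c : v \in registered I ++ unregistered I -> c < n ->
  approves r I v c = (index c v < r).
Proof.
move=> /vote_perm hv hc; have hsz : size v = n by rewrite (perm_size hv) size_iota.
have hcv : c \in v by rewrite (perm_mem hv) mem_iota.
have huv : uniq v by rewrite (perm_uniq hv) iota_uniq.
rewrite /approves lt0n sum_nat_eq0 negb_forall; apply/existsP/idP => [[i]|h].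
  by rewrite /= eqb0 negbK => /andP[hi /eqP <-]; rewrite index_uniq // hsz.
have hi : index c v < n by rewrite -hsz index_mem.
by exists (Ordinal hi); rewrite /= eqb0 negbK h nth_index //= eqxx.
Qed.

Lemma axis_at_lt z : z < n -> axis_at I z < n.
Proof. by move=> hz; rewrite -valid_axis_mem mem_nth // valid_axis_size. Qed.

Lemma unreg_vote u : u < U -> nth [::] (unregistered I) u \in registered I ++ unregistered I.
Proof. by move=> hu; rewrite mem_cat mem_nth // orbT. Qed.

Lemma unreg_apprE u z : u < U -> z < n ->
  A u z = (index (axis_at I z) (nth [::] (unregistered I) u) < r).
Proof.
by move=> hu hz; rewrite /A /unreg_appr hz /= approvesE ?unreg_vote ?axis_at_lt.
Qed.

Lemma unreg_appr_lt u z : A u z -> z < n.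
Proof. by case/andP. Qed.

Lemma valid_window u x y : u < U -> A u q -> far_appr q r A u x ->
  far_appr q r A u y -> y < x + r.
Proof.
move=> hu hq /andP[fx hx] /andP[fy hy].
have hqn := unreg_appr_lt hq; have hxn := unreg_appr_lt hx; have hyn := unreg_appr_lt hy.
have hp : k_peaked 2 (axis I) (nth [::] (unregistered I) u).
  by case: I_valid => _ _ _ _; apply; apply: unreg_vote.
rewrite !unreg_apprE // in hq hx hy.
exact: (two_peaked_window axis_perm (vote_perm (unreg_vote hu)) r_gt0 hqn hxn hyn).
Qed.

Lemma count_nth_sum (a : pred (seq nat)) s :
  count a s = \sum_(u < size s) a (nth [::] s u).
Proof.
by rewrite -sum1_count big_mkcond /= (big_nth [::]) big_mkord; apply: eq_bigr => u _; case: (a _).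
Qed.

Lemma count_mask_sum (a : pred (seq nat)) m s :
  count a (mask m s) = \sum_(u < size s) (nth false m u && a (nth [::] s u)).
Proof.
elim: s m => [|v s IH] [|b m]; rewrite ?big_ord0 //.
  by rewrite mask0s big1 // => u _; rewrite nth_nil.
by rewrite big_ord_recl /= -IH; case: b.
Qed.

Lemma score_sum m z : z < n ->
  score r (registered I ++ mask m (unregistered I)) (axis_at I z) =
  S z + \sum_(u < U) (nth false m u && A u z).
Proof.
move=> hz; rewrite /score count_cat count_mask_sum count_nth_sum; congr (_ + _).
  apply: eq_bigr => u _; congr nat_of_bool; rewrite approvesE ?axis_at_lt //.
  by rewrite mem_cat mem_nth.
by apply: eq_bigr => u _; rewrite unreg_apprE.
Qed.

Lemma axis_at_p : axis_at I q = pcand I.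
Proof. by rewrite /axis_at nth_index // valid_axis_mem. Qed.

Lemma p_pos_lt_n : q < n.
Proof. by rewrite /q /p_pos -valid_axis_size index_mem valid_axis_mem. Qed.

(** Dropping added votes that do not approve p keeps the score of p and raises no other score, so
    only approving votes need be considered. *)
Lemma yes_instanceP :
  yes_instance r I <-> exists T, solution n q U (budget I) A S T.
Proof.
have hq := p_pos_lt_n; split=> [[m [hm hw]]|[T [hT hR hw]]].
  exists (fun u => [&& u < U, nth false m u & A u q]); split=> [u|  |z hz hzq].
  - by case/and3P.
  - apply: leq_trans hm; rewrite -(count_predT (mask _ _)) count_mask_sum.
    by apply: leq_sum => u _; case: (nth false m u); rewrite ?andbF //= leq_b1.
  have hzp : axis_at I z != pcand I.
    by rewrite -axis_at_p nth_uniq ?valid_axis_size ?valid_axis_uniq.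
  have := hw _ (axis_at_lt hz) hzp; rewrite -axis_at_p !score_sum //.
  have -> : \sum_(u < U) (nth false m u && A u q) =
            \sum_(u < U) [&& u < U, nth false m u & A u q].
    by apply: eq_bigr => u _; rewrite ltn_ord.
  apply: leq_ltn_trans; rewrite leq_add2l; apply: leq_sum => u _.
  by rewrite ltn_ord /=; case: (nth false m u); case: (A u q); case: (A u z).
exists (mkseq T U); have hnth (u : 'I_U) : nth false (mkseq T U) u = T u by rewrite nth_mkseq.
split.
  rewrite -(count_predT (mask _ _)) count_mask_sum; apply: leq_trans hR.
  by apply: leq_sum => u _; rewrite hnth andbT.
move=> c hc hcp; pose z := index c (axis I).
have hz : z < n by rewrite /z -valid_axis_size index_mem valid_axis_mem.
have ec : axis_at I z = c by rewrite /axis_at nth_index // valid_axis_mem.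
have hzq : z != q by apply: contraNneq hcp => e; rewrite -ec e axis_at_p.
rewrite -ec -axis_at_p !score_sum //.
have := hw z hz hzq; congr (_ + _ < _ + _).
  by apply: eq_bigr => u _; rewrite hnth.
by apply: eq_bigr => u _; rewrite hnth; case hTu : (T u) => //; have [_ ->] := hT _ hTu.
Qed.

Let N := size (encode I).

Lemma sweep_correct (b : bool) : (b <-> yes_instance r I) ->
  forall s, reg s 0 = N -> (forall x, x != 0 -> reg s x = 0) ->
    (forall i, bits s false i = nth false (rev (encode I)) i) ->
    (forall i, bits s true i = false) ->
    execs N (explore (dim r) (sweep_terms r)) s
      (fun s' => bits s' true (reg s' 1) = b).
Proof.
rewrite yes_instanceP /N encode_numsE => hb s h0 h1 h2 h3.
have hpa : pcand I \in axis I by rewrite valid_axis_mem.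
have hspec := sweep_terms_spec valid_axis_size valid_votes_size hpa valid_axis_uniq r_gt0.
have nN := n_lt_N valid_axis_size valid_votes_size.
have UN := U_lt_N valid_axis_size valid_votes_size.
have RN := R_lt_N valid_axis_size valid_votes_size.
have h := explore_spec hspec (Inv := sweep_inv n q r U (budget I) A S (size (encode_nums (nums I))))
  (sweep_inv_start _ _ _ _ _ _ _ _) (sweep_inv_step nN UN RN r_gt0 valid_window)
  (sweep_inv_vector nN UN RN) h0 (h1 1 isT) h2 h3.
apply: execs_conseq h _ => s' [-> [hc hs]]; apply/idP/idP => [/hs [x [[_ /hb //]|[T hp]] e]|].
  (* A partial selection has its address inside the table, so the final address can only be marked
     by acceptance. *)
  by have := vector_lt (digits_lt nN UN RN hp); rewrite e ltnn.
move/hb => [T hT]; apply: hc (path_accept nN UN RN hT r_gt0 valid_window) _.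
by rewrite /accept_vec horner_cons horner_zero size_nseq addn0 -expnS.
Qed.

End Correctness.

Theorem theorem1 (r : nat) : 1 <= r ->
  exists (M : TM) (c d : nat),
    forall I : instance, valid_instance 2 I ->
      let t := c * size (encode I) ^ d + c in
      (yes_instance r I -> accepts_within M t (encode I)) /\
      (~ yes_instance r I -> rejects_within M t (encode I)).
Proof.
move=> r_gt0; pose c0 := explore (dim r) (sweep_terms r).
have [C [D hCD]] := poly_time_bound c0.
(* The factor [2 ^ D] absorbs the passage from [N.+1 ^ D] to [N ^ D], valid since the encoding is
   never empty. *)
exists (machine (num_regs c0) (decision_prog c0)), (C * 2 ^ D), D => I hI t.
have hne : encode I != [::] by rewrite -size_eq0 /encode size_cat size_rcons.
have ht : time_bound c0 (size (encode I)) <= t.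
  apply: leq_trans (hCD _) _; rewrite /t -mulnA -expnMn.
  have hN : 0 < size (encode I) by rewrite lt0n size_eq0.
  apply: leq_trans (leq_addr _ _); rewrite leq_mul2l; apply/orP; right.
  by case: (D) => // D'; rewrite leq_exp2r // mul2n -addnn -addn1 leq_add2l.
have hdec b hb := decision_correct hne (sweep_correct r_gt0 hI (b := b) hb) ht.
split=> hy; rewrite /accepts_within /rejects_within.
  by rewrite (hdec true).
by rewrite (hdec false).
Qed.
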